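(* Let $(A,\{\bullet,\bullet\}_J)$ be a Jacobi algebra over a field $k$, let $I$ be the kernel of the multiplication map $\mu: A\otimes A\to A$, let $\mathcal J^1(A) := (A\otimes A)/I^2 \cong A\oplus\Omega^1(A)$ be the 1-jet space of $A$, and let $j^1: A\to\mathcal J^1(A)$ be the 1-jet map $a\mapsto 1\otimes a \pmod{I^2}$. 1. The pair $(A,\mathcal J^1(A))$ is a Lie--Rinehart algebra with anchor $$\rho_{\mathcal J^1}:\mathcal J^1(A)\longrightarrow \mathrm{Der}_k(A),\qquad j^1(a)\longmapsto \Phi_a := \{a,\bullet\}_J+\{1,a\}_J\cdot\bullet$$ and Lie bracket on $\mathcal J^1(A)$ given by $$[j^1(f),j^1(g)]_{\mathcal J^1(A)} = j^1(\{f,g\}_J).$$ 2. The map $$\varphi_{\mathcal J^1}:\mathcal J^1(A)\longrightarrow A,\qquad a\cdot j^1(b)\longmapsto\{a,b\}_J$$ is a flat right $(A,\mathcal J^1(A))$-connection character on $A$, which induces a flat right $(A,\mathcal J^1(A))$-connection on $A$. Consequently, the universal enveloping algebra of the Lie--Rinehart algebra $(A,\mathcal J^1(A))$ admits an antipode.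
   Context: Unadorned $\otimes$ means $\otimes_k$. Algebras denoted $A$ are commutative with identity $1$. Jacobi algebra over $k$: a commutative $k$-algebra $(A,\cdot)$ with a $k$-linear Lie bracket $\{\bullet,\bullet\}_J$ satisfying $\{a\cdot b,c\}_J = a\cdot\{b,c\}_J+b\cdot\{a,c\}_J-a\cdot b\cdot\{1,c\}_J$ for all $a,b,c\in A$. $A\otimes A$ is an $A$-module by multiplication on the left tensor factor, and $\mathcal J^1(A)$ inherits this structure. $\Omega^1(A)$ is the $A$-module of Kähler differentials; the isomorphism $\mathcal J^1(A)\cong A\oplus\Omega^1(A)$ identifies $a\cdot j^1(b)$ with $(a\cdot b,\,a\cdot db)$. As an $A$-module, $\mathcal J^1(A)$ is generated by the elements $j^1(a)$, $a\in A$; the anchor is extended $A$-linearly, and the bracket is extended from these generators by skew-symmetry, additivity and the Leibniz rule for Lie--Rinehart algebras. The map $\varphi_{\mathcal J^1}$ is extended additively. Lie--Rinehart algebra $(A,L)$ over $k$: $A$ is a commutative $k$-algebra, $(L,[\bullet,\bullet]_L)$ a Lie algebra over $k$ with a left $A$-module structure, together with an $A$-linear Lie algebra homomorphism $\rho:L\to\mathrm{Der}_k(A)$ (the anchor) such that $[\xi,a\cdot\zeta]_L=a\cdot[\xi,\zeta]_L+\rho(\xi)(a)\cdot\zeta$ for $a\in A$, $\xi,\zeta\in L$. Right $(A,L)$-connection on $A$: a $k$-linear map $\nabla^r:A\otimes L\to A$, $a\otimes\xi\mapsto\nabla^r_\xi(a)$, with $\nabla^r_\xi(a\cdot b)=\nabla^r_{a\cdot\xi}(b)=a\cdot\nabla^r_\xi(b)-\rho(\xi)(a)\cdot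 b$. It is flat if $\nabla^r_\xi\nabla^r_\zeta-\nabla^r_\zeta\nabla^r_\xi+\nabla^r_{[\xi,\zeta]_L}=0$ for all $\xi,\zeta\in L$. Right $(A,L)$-connection character on $A$: a $k$-linear map $\delta:L\to A$ with $\delta(a\cdot\xi)=a\cdot\delta(\xi)-\rho(\xi)(a)$. Right connection characters correspond bijectively to right connections on $A$ via $\delta(\xi)=\nabla^r_\xi(1)$, $\nabla^r_\xi(a)=\delta(a\cdot\xi)$. A character is called flat if the corresponding connection is flat, equivalently $-\rho(\xi)(\delta(\zeta))+\rho(\zeta)(\delta(\xi))+\delta([\xi,\zeta]_L)=0$ for all $\xi,\zeta\in L$. Universal enveloping algebra $V=V(A,L)$: the universal associative $k$-algebra equipped with a $k$-algebra map $A\to V$ and a Lie algebra map $L\to(V,[\bullet,\bullet])$ (commutator bracket), $\xi\mapsto\bar\xi$, such that $[\bar\xi,a]=\rho(\xi)(a)$ and $a\bar\xi=\overline{a\cdot\xi}$ for $a\in A$, $\xi\in L$. It carries a canonical left Hopf algebroid (in particular left bialgebroid) structure over $A$: source and target maps $s=t$ are both the canonical map $A\to V$; the coproduct $\Delta:V\to V\otimes_A V$ (tensor product of $V$ with itself as left $A$-modules), written $\Delta(h)=h_{(1)}\otimes_A h_{(2)}$, is determined by multiplicativity and $\Delta(a)=a\otimes_A 1$, $\Delta(\bar\xi)=\bar\xi\otimes_A1+1\otimes_A\bar\xi$; the counit $\varepsilon:V\to A$ sends $u$ to $u\cdot1_A$ for the left $V$-action on $A$ given by multiplication by elements of $A$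 and by the anchor. ''$V$ admits an antipode'' means that there is an antipode turning this left Hopf algebroid structure on $V$ into a full Hopf algebroid in the sense of Böhm and Szlachányi. That is: there is a bijective $k$-algebra anti-homomorphism $S:V\to V$ such that $S\circ t=s$ and, for all $h\in V$, in $V\otimes_A V$, $$S(h_{(1)})_{(1')}h_{(2)}\otimes_A S(h_{(1)})_{(2')}=1\otimes_A S(h),\qquad S^{-1}(h_{(2)})_{(1')}\otimes_A S^{-1}(h_{(2)})_{(2')}h_{(1)}=S^{-1}(h)\otimes_A1,$$ where primed indices denote a further application of $\Delta$. *)

(* Defs.v *)
From HB Require Import structures.
From Stdlib Require Import Relation_Operators.
From mathcomp Require Import all_boot all_algebra.
From mathcomp Require Import boolp.

Set Implicit Arguments.
Unset Strict Implicit.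
Unset Printing Implicit Defensive.

Import GRing.Theory.
Local Open Scope ring_scope.
Local Open Scope quotient_scope.

(* Conventions.
   - MathComp's algType k excludes the zero ring, so a commutative k-algebra is
     taken here to be a comPzRingType A with a structure map
     kA : {rmorphism k -> A}; the scalar c acts on a : A as kA c * a, and on an
     element x of an A-module as kA c *: x.
   - Tensor products and the enveloping algebra are presented by generators
     and relations: a type of formal expressions divided by the least
     congruence that contains the relations.                                  *)

Section Quo.
Variables (T : Type) (e : T -> T -> Prop).

Definition quo_rel : rel {classic T} :=
  fun x y => `[< clos_refl_sym_trans T e x y >].

Lemma quo_rel_refl : reflexive quo_rel.
Proof. by move=> x; apply/asboolP/rst_refl. Qed.

Lemma quo_rel_sym : symmetric quo_rel.
Proof. by move=> x y; apply/asboolP/asboolP => h; apply: rst_sym. Qed.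

Lemma quo_rel_trans : transitive quo_rel.
Proof.
by move=> y x z /asboolP xy /asboolP yz; apply/asboolP/(@rst_trans _ _ x y z).
Qed.

Canonical quo_equiv := EquivRel quo_rel quo_rel_refl quo_rel_sym quo_rel_trans.

Definition quo : Type := {eq_quot quo_equiv}.
HB.instance Definition _ := Choice.copy quo {eq_quot quo_equiv}.

Definition cls (x : T) : quo := \pi_({eq_quot quo_equiv}) (x : {classic T}).
Definition rep (q : quo) : T := repr (q : {eq_quot quo_equiv}).

Lemma repK q : cls (rep q) = q. Proof. exact: reprK. Qed.

Lemma clsE x y : cls x = cls y <-> clos_refl_sym_trans T e x y.
Proof.
split; first by move/eqmodP/asboolP.
by move=> h; apply/eqmodP/asboolP.
Qed.

Lemma cls_eq x y : e x y -> cls x = cls y.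
Proof. by move=> h; apply/clsE/rst_step. Qed.

Lemma quoW (P : quo -> Prop) : (forall x, P (cls x)) -> forall q, P q.
Proof. by move=> h q; rewrite -(repK q). Qed.

Lemma cls_resp (U : Type) (f : T -> U) :
  (forall x y, e x y -> f x = f y) -> forall x y, cls x = cls y -> f x = f y.
Proof.
by move=> fe x y /clsE; elim=> // x1 y1 z1 _ -> _ ->.
Qed.

Definition qlift (U : Type) (f : T -> U) (q : quo) : U := f (rep q).

Lemma qliftE (U : Type) (f : T -> U) :
  (forall x y, e x y -> f x = f y) -> forall x, qlift f (cls x) = f x.
Proof. by move=> fe x; apply: (cls_resp fe); rewrite repK. Qed.

End Quo.

(* M ⊗_R N as an abelian group; the actions of R are explicit arguments because
   the same ring is used below with several module structures.                *)
Section Tensor.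
Variables (R : Type) (M N : zmodType) (sM : R -> M -> M) (sN : R -> N -> N).

Inductive tterm : Type :=
| TPure of M & N
| TZero
| TAdd of tterm & tterm
| TOpp of tterm.

Inductive trel : tterm -> tterm -> Prop :=
| TrAddl s s' t : trel s s' -> trel (TAdd s t) (TAdd s' t)
| TrAddr s t t' : trel t t' -> trel (TAdd s t) (TAdd s t')
| TrOpp s s' : trel s s' -> trel (TOpp s) (TOpp s')
| TrAddA s t u : trel (TAdd s (TAdd t u)) (TAdd (TAdd s t) u)
| TrAddC s t : trel (TAdd s t) (TAdd t s)
| TrAdd0 s : trel (TAdd TZero s) s
| TrAddN s : trel (TAdd (TOpp s) s) TZero
| TrPureDl m m' n : trel (TPure (m + m') n) (TAdd (TPure m n) (TPure m' n))
| TrPureDr m n n' : trel (TPure m (n + n')) (TAdd (TPure m n) (TPure m n'))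
| TrBal r m n : trel (TPure (sM r m) n) (TPure m (sN r n)).

Definition tens : Type := quo trel.
HB.instance Definition _ := Choice.on tens.

Definition pure (m : M) (n : N) : tens := cls trel (TPure m n).
Definition tzero : tens := cls trel TZero.
Definition tadd (x y : tens) : tens := cls trel (TAdd (rep x) (rep y)).
Definition topp (x : tens) : tens := cls trel (TOpp (rep x)).

Fact taddE s t : tadd (cls trel s) (cls trel t) = cls trel (TAdd s t).
Proof.
transitivity (cls trel (TAdd s (rep (cls trel t)))).
  apply: (@cls_resp _ trel _ (fun u => cls trel (TAdd u _))) (repK _).
  by move=> x y h; apply/cls_eq/TrAddl.
apply: (@cls_resp _ trel _ (fun u => cls trel (TAdd _ u))) (repK _).
by move=> x y h; apply/cls_eq/TrAddr.
Qed.

Fact toppE s : topp (cls trel s) = cls trel (TOpp s).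
Proof.
apply: (@cls_resp _ trel _ (fun u => cls trel (TOpp u))) (repK _).
by move=> x y h; apply/cls_eq/TrOpp.
Qed.

Fact taddA : associative tadd.
Proof.
elim/quoW=> s; elim/quoW=> t; elim/quoW=> u.
by rewrite !taddE; apply/cls_eq/TrAddA.
Qed.
Fact taddC : commutative tadd.
Proof.
by elim/quoW=> s; elim/quoW=> t; rewrite !taddE; apply/cls_eq/TrAddC.
Qed.
Fact tadd0 : left_id tzero tadd.
Proof. by elim/quoW=> s; rewrite taddE; apply/cls_eq/TrAdd0. Qed.
Fact taddN : left_inverse tzero topp tadd.
Proof. by elim/quoW=> s; rewrite toppE taddE; apply/cls_eq/TrAddN. Qed.

HB.instance Definition _ := GRing.isZmodule.Build tens taddA taddC tadd0 taddN.

Lemma pureDl m m' n : pure (m + m') n = pure m n + pure m' n.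
Proof. by rewrite [RHS]taddE; apply/cls_eq/TrPureDl. Qed.

Lemma pureDr m n n' : pure m (n + n') = pure m n + pure m n'.
Proof. by rewrite [RHS]taddE; apply/cls_eq/TrPureDr. Qed.

Lemma pure_bal r m n : pure (sM r m) n = pure m (sN r n).
Proof. exact/cls_eq/TrBal. Qed.

Lemma pure0l n : pure 0 n = 0.
Proof. by apply: (addrI (pure 0 n)); rewrite -pureDl !addr0. Qed.

Lemma pure0r m : pure m 0 = 0.
Proof. by apply: (addrI (pure m 0)); rewrite -pureDr !addr0. Qed.

Lemma pureNl m n : pure (- m) n = - pure m n.
Proof. by apply: (addrI (pure m n)); rewrite -pureDl !subrr pure0l. Qed.

Lemma pureNr m n : pure m (- n) = - pure m n.
Proof. by apply: (addrI (pure m n)); rewrite -pureDr !subrr pure0r. Qed.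

Fact tensW (P : tens -> Prop) :
    (forall m n, P (pure m n)) -> P 0 -> (forall x y, P x -> P y -> P (x + y)) ->
    (forall x, P x -> P (- x)) ->
  forall x, P x.
Proof.
move=> Pp P0 PD PN; elim/quoW; elim=> [m n||s IHs t IHt|s IHs]; first exact: Pp.
- exact: P0.
- by rewrite -taddE; apply: PD.
- by rewrite -toppE; apply: PN.
Qed.

Lemma tens_sum (x : tens) :
  exists s : seq (M * N), x = \sum_(p <- s) pure p.1 p.2.
Proof.
elim/tensW: x => [m n||_ _ [s ->] [t ->]|_ [s ->]].
- by exists [:: (m, n)]; rewrite big_seq1.
- by exists [::]; rewrite big_nil.
- by exists (s ++ t); rewrite big_cat.
- exists [seq (- p.1, p.2) | p <- s]; rewrite big_map -sumrN.
  by apply: eq_bigr => p _; rewrite pureNl.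
Qed.

Lemma tens_ind (P : tens -> Prop) :
    (forall m n, P (pure m n)) -> (forall x y, P x -> P y -> P (x + y)) ->
  forall x, P x.
Proof.
move=> Pp PD x; have [s ->] := tens_sum x; elim: s => [|p s IHs].
  by rewrite big_nil -(pure0l 0).
by rewrite big_cons; apply: PD.
Qed.

Section Lift.
Variables (P : zmodType) (f : M -> N -> P).

Fixpoint teval (t : tterm) : P :=
  match t with
  | TPure m n => f m n
  | TZero => 0
  | TAdd s t => teval s + teval t
  | TOpp s => - teval s
  end.

(* Additive, with value f m n on pure m n, only if f is balanced (see below). *)
Definition tlift (x : tens) : P := qlift teval x.

Definition balanced :=
  [/\ forall m m' n, f (m + m') n = f m n + f m' n,
      forall m n n', f m (n + n') = f m n + f m n'
    & forall r m n, f (sM r m) n = f m (sN r n)].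

Hypothesis fB : balanced.

Fact tevalE s t : trel s t -> teval s = teval t.
Proof.
case: fB => fl fr fb; elim=> //= {s t}.
- by move=> s s' t _ ->.
- by move=> s t t' _ ->.
- by move=> s s' _ ->.
- by move=> s t u; rewrite addrA.
- by move=> s t; rewrite addrC.
- by move=> s; rewrite add0r.
- by move=> s; rewrite addNr.
Qed.

Lemma tlift_pure m n : tlift (pure m n) = f m n.
Proof. exact: (qliftE tevalE). Qed.

Lemma tliftD x y : tlift (x + y) = tlift x + tlift y.
Proof.
by elim/quoW: x => s; elim/quoW: y => t; rewrite [_ + _ in LHS]taddE /tlift
  !(qliftE tevalE).
Qed.

Lemma tlift0 : tlift 0 = 0.
Proof. by apply: (addrI (tlift 0)); rewrite -tliftD !addr0. Qed.

Lemma tliftN x : tlift (- x) = - tlift x.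
Proof. by apply: (addrI (tlift x)); rewrite -tliftD !subrr tlift0. Qed.

End Lift.

End Tensor.

Section KAlgebra.
Variables (k : fieldType) (A : comPzRingType) (kA : {rmorphism k -> A}).

Record is_lie_algebra (M : zmodType) (sc : k -> M -> M) (br : M -> M -> M) :
    Prop := IsLieAlgebra {
  lieDl : forall x y z, br (x + y) z = br x z + br y z;
  lieDr : forall x y z, br x (y + z) = br x y + br x z;
  lieZl : forall c x y, br (sc c x) y = sc c (br x y);
  lieZr : forall c x y, br x (sc c y) = sc c (br x y);
  lie_alt : forall x, br x x = 0;
  lie_jacobi : forall x y z,
    br x (br y z) + br y (br z x) + br z (br x y) = 0 }.

Record is_jacobi_algebra (J : A -> A -> A) : Prop := IsJacobiAlgebra {
  jacobi_lie : is_lie_algebra (fun c a => kA c * a) J;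
  jacobi_leibniz : forall a b c,
    J (a * b) c = a * J b c + b * J a c - a * b * J 1 c }.

Record is_derivation (D : A -> A) : Prop := IsDerivation {
  derD : forall a b, D (a + b) = D a + D b;
  derZ : forall c a, D (kA c * a) = kA c * D a;
  derM : forall a b, D (a * b) = a * D b + D a * b }.

Record lieRinehart (L : lmodType A) : Type := LieRinehart {
  anchor : L -> A -> A;
  bracket : L -> L -> L;
  bracket_lie : is_lie_algebra (fun c xi => kA c *: xi) bracket;
  anchor_der : forall xi, is_derivation (anchor xi);
  anchorD : forall xi zeta a, anchor (xi + zeta) a = anchor xi a + anchor zeta a;
  anchorZ : forall a xi b, anchor (a *: xi) b = a * anchor xi b;
  anchor_bracket : forall xi zeta a, anchor (bracket xi zeta) a =
    anchor xi (anchor zeta a) - anchor zeta (anchor xi a);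
  bracket_leibniz : forall xi a zeta, bracket xi (a *: zeta) =
    a *: bracket xi zeta + anchor xi a *: zeta }.

Definition kscale (c : k) (a : A) : A := kA c * a.

Definition tensA : Type := tens kscale kscale.
HB.instance Definition _ := GRing.Zmodule.on tensA.

Definition pureA (a b : A) : tensA := pure kscale kscale a b.

Fact mult_bal : balanced kscale kscale (fun a b : A => a * b).
Proof.
split=> [a b c|a b c|c a b]; rewrite ?mulrDl ?mulrDr //.
by rewrite /kscale mulrCA mulrA.
Qed.

Definition multA : tensA -> A := tlift (fun a b : A => a * b).

Definition tm1 (a b : A) (y : tensA) : tensA :=
  tlift (fun c d => pureA (a * c) (b * d)) y.

Fact tm1_bal a b :
  balanced kscale kscale (fun c d => pureA (a * c) (b * d)).
Proof.
split=> [c c' d|c d d'|r c d].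
- by rewrite mulrDr /pureA pureDl.
- by rewrite mulrDr /pureA pureDr.
- by rewrite /kscale mulrCA -/(kscale _ _) /pureA pure_bal /kscale mulrCA.
Qed.

Definition tm (x y : tensA) : tensA := tlift (fun a b => tm1 a b y) x.

Fact tm_bal y : balanced kscale kscale (fun a b => tm1 a b y).
Proof.
split=> [a a' b|a b b'|r a b]; rewrite /tm1.
- elim/tens_ind: y => [c d|x y IHx IHy].
    by rewrite !(tlift_pure (tm1_bal _ _)) mulrDl /pureA pureDl.
  by rewrite !(tliftD (tm1_bal _ _)) IHx IHy addrACA.
- elim/tens_ind: y => [c d|x y IHx IHy].
    by rewrite !(tlift_pure (tm1_bal _ _)) mulrDl /pureA pureDr.
  by rewrite !(tliftD (tm1_bal _ _)) IHx IHy addrACA.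
- elim/tens_ind: y => [c d|x y IHx IHy].
    rewrite !(tlift_pure (tm1_bal _ _)) /kscale -!mulrA.
    exact: (pure_bal kscale kscale).
  by rewrite !(tliftD (tm1_bal _ _)) IHx IHy.
Qed.

Fact tmE a b c d : tm (pureA a b) (pureA c d) = pureA (a * c) (b * d).
Proof. by rewrite /tm (tlift_pure (tm_bal _)) /tm1 (tlift_pure (tm1_bal _ _)). Qed.

Fact tmDl x y z : tm (x + y) z = tm x z + tm y z.
Proof. exact: (tliftD (tm_bal z)). Qed.

Fact tmDr x y z : tm x (y + z) = tm x y + tm x z.
Proof.
elim/tens_ind: x => [a b|x x' IHx IHx']; last by rewrite !tmDl IHx IHx' addrACA.
by rewrite /tm !(tlift_pure (tm_bal _)) /tm1 (tliftD (tm1_bal _ _)).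
Qed.

Fact tmA : associative tm.
Proof.
move=> x y z.
elim/tens_ind: x => [a b|x x' IH IH']; last by rewrite !tmDl IH IH'.
elim/tens_ind: y => [c d|y y' IH IH']; last by rewrite !(tmDl, tmDr) IH IH'.
elim/tens_ind: z => [e f|z z' IH IH']; last by rewrite !tmDr IH IH'.
by rewrite !tmE !mulrA.
Qed.

Fact tmC : commutative tm.
Proof.
move=> x y.
elim/tens_ind: x => [a b|x x' IH IH']; last by rewrite tmDl tmDr IH IH'.
elim/tens_ind: y => [c d|y y' IH IH']; last by rewrite tmDl tmDr IH IH'.
by rewrite !tmE mulrC [b * d]mulrC.
Qed.

Fact tm1x : left_id (pureA 1 1) tm.
Proof.
elim/tens_ind=> [a b|x x' IH IH']; last by rewrite tmDr IH IH'.
by rewrite tmE !mul1r.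
Qed.

HB.instance Definition _ :=
  GRing.Zmodule_isComPzRing.Build tensA tmA tmC tm1x tmDl.

Lemma pureAM a b c d : pureA a b * pureA c d = pureA (a * c) (b * d).
Proof. exact: tmE. Qed.

Lemma multA_pure a b : multA (pureA a b) = a * b.
Proof. exact: (tlift_pure mult_bal). Qed.

Definition kerI (x : tensA) : Prop := multA x = 0.

Definition kerI2 (x : tensA) : Prop :=
  exists2 s : seq (tensA * tensA),
    (forall p, p \in s -> kerI p.1 /\ kerI p.2) & x = \sum_(p <- s) p.1 * p.2.

Definition jet_rel (x y : tensA) : Prop := kerI2 (x - y).

Definition jet : Type := quo jet_rel.
HB.instance Definition _ := Choice.on jet.

Definition jet_proj (x : tensA) : jet := cls jet_rel x.

Lemma jetW (P : jet -> Prop) : (forall x, P (jet_proj x)) -> forall x, P x.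
Proof. exact: quoW. Qed.

Definition jet1 (a : A) : jet := jet_proj (pureA 1 a).

Lemma multAM x y : multA (x * y) = multA x * multA y.
Proof.
have mD : {morph multA : u v / u + v} := tliftD mult_bal.
elim/tens_ind: x => [a b|x x' IH IH']; last by rewrite mD !mulrDl mD IH IH'.
elim/tens_ind: y => [c d|y y' IH IH']; last by rewrite mD !mulrDr mD IH IH'.
by rewrite pureAM !multA_pure mulrACA.
Qed.

Lemma kerI2_0 : kerI2 0.
Proof. by exists [::]; rewrite ?big_nil. Qed.

Lemma kerI2D x y : kerI2 x -> kerI2 y -> kerI2 (x + y).
Proof.
move=> [s hs ->] [t ht ->]; exists (s ++ t); last by rewrite big_cat.
by move=> p; rewrite mem_cat => /orP[/hs|/ht].
Qed.

Lemma kerI2M z x : kerI2 x -> kerI2 (z * x).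
Proof.
move=> [s hs ->]; exists [seq (z * p.1, p.2) | p <- s].
  move=> _ /mapP[p ps ->] /=; have [h1 h2] := hs p ps; split=> //.
  by rewrite /kerI multAM h1 mulr0.
by rewrite big_map mulr_sumr; apply: eq_bigr => p _; rewrite mulrA.
Qed.

Lemma kerI2N x : kerI2 x -> kerI2 (- x).
Proof. by rewrite -mulN1r; apply: kerI2M. Qed.

Lemma jet_projE x y : jet_proj x = jet_proj y <-> kerI2 (x - y).
Proof.
split; last exact: cls_eq.
move/clsE; elim=> {x y} // [x|x y _ h|x y z _ h1 _ h2].
- by rewrite subrr; apply: kerI2_0.
- by rewrite -opprB; apply: kerI2N.
- by rewrite -(subrKA y); apply: kerI2D.
Qed.

Definition jzero : jet := jet_proj 0.
Definition jadd (x y : jet) : jet := jet_proj (rep x + rep y).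
Definition jopp (x : jet) : jet := jet_proj (- rep x).
Definition jscale (a : A) (x : jet) : jet := jet_proj (pureA a 1 * rep x).

Fact rep_proj x : kerI2 (rep (jet_proj x) - x).
Proof. by apply/jet_projE; apply: repK. Qed.

Fact jaddE x y : jadd (jet_proj x) (jet_proj y) = jet_proj (x + y).
Proof. by apply/jet_projE; rewrite opprD addrACA; apply/kerI2D/rep_proj/rep_proj. Qed.

Fact joppE x : jopp (jet_proj x) = jet_proj (- x).
Proof. by apply/jet_projE; rewrite -opprD; apply/kerI2N/rep_proj. Qed.

Fact jscaleE a x : jscale a (jet_proj x) = jet_proj (pureA a 1 * x).
Proof. by apply/jet_projE; rewrite -mulrBr; apply/kerI2M/rep_proj. Qed.

Fact jaddA : associative jadd.
Proof.
by elim/jetW=> x; elim/jetW=> y; elim/jetW=> z; rewrite !jaddE addrA.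
Qed.
Fact jaddC : commutative jadd.
Proof. by elim/jetW=> x; elim/jetW=> y; rewrite !jaddE addrC. Qed.
Fact jadd0 : left_id jzero jadd.
Proof. by elim/jetW=> x; rewrite !jaddE add0r. Qed.
Fact jaddN : left_inverse jzero jopp jadd.
Proof. by elim/jetW=> x; rewrite joppE jaddE addNr. Qed.

HB.instance Definition _ := GRing.isZmodule.Build jet jaddA jaddC jadd0 jaddN.

Lemma jet_projD x y : jet_proj (x + y) = jet_proj x + jet_proj y.
Proof. by rewrite [RHS]jaddE. Qed.

Fact jscaleA a b x : jscale a (jscale b x) = jscale (a * b) x.
Proof.
elim/jetW: x => x; rewrite !jscaleE mulrA pureAM mulr1 //.
Qed.
Fact jscale1 : left_id 1 jscale.
Proof. by elim/jetW=> x; rewrite jscaleE; congr jet_proj; apply: mul1r. Qed.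
Fact jscaleDr : right_distributive jscale +%R.
Proof.
move=> a; elim/jetW=> x; elim/jetW=> y.
by rewrite -jet_projD !jscaleE mulrDr jet_projD.
Qed.
Fact jscaleDl x : {morph jscale^~ x : a b / a + b}.
Proof.
move=> a b; elim/jetW: x => x.
by rewrite !jscaleE -jet_projD -mulrDl /pureA pureDl.
Qed.

HB.instance Definition _ := GRing.Zmodule_isLmodule.Build A jet
  jscaleA jscale1 jscaleDr jscaleDl.

Lemma jet_projZ a x : jet_proj (pureA a 1 * x) = a *: jet_proj x.
Proof. by rewrite [RHS]jscaleE. Qed.

Lemma jet_pure a b : jet_proj (pureA a b) = a *: jet1 b.
Proof. by rewrite -jet_projZ pureAM mulr1 mul1r. Qed.


(* Anchor and bracket prescribed on the generators jet1 a; the axioms of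
   lieRinehart then determine both on all of jet.                             *)
Definition jacobi_jet (J : A -> A -> A) (X : lieRinehart jet) : Prop :=
  (forall a b, anchor X (jet1 a) b = J a b + J 1 a * b) /\
  (forall f g, bracket X (jet1 f) (jet1 g) = jet1 (J f g)).

Section Enveloping.
Variables (L : lmodType A) (X : lieRinehart L).

(* A k-linear map A ⊗ L -> A is given as the k-bilinear map L -> A -> A,
   nabla xi a standing for ∇^r_xi(a).                                         *)
Record right_connection (nabla : L -> A -> A) : Prop := RightConnection {
  rconDl : forall xi zeta a, nabla (xi + zeta) a = nabla xi a + nabla zeta a;
  rconDr : forall xi a b, nabla xi (a + b) = nabla xi a + nabla xi b;
  rconZl : forall c xi a, nabla (kA c *: xi) a = kA c * nabla xi a;
  rconZr : forall c xi a, nabla xi (kA c * a) = kA c * nabla xi a;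
  rconA : forall xi a b, nabla xi (a * b) = nabla (a *: xi) b;
  rconM : forall xi a b,
    nabla xi (a * b) = a * nabla xi b - anchor X xi a * b }.

Definition flat_connection (nabla : L -> A -> A) : Prop :=
  forall xi zeta a, nabla xi (nabla zeta a) - nabla zeta (nabla xi a)
                    + nabla (bracket X xi zeta) a = 0.

Record right_character (delta : L -> A) : Prop := RightCharacter {
  rchD : forall xi zeta, delta (xi + zeta) = delta xi + delta zeta;
  rchZ : forall c xi, delta (kA c *: xi) = kA c * delta xi;
  rchM : forall a xi, delta (a *: xi) = a * delta xi - anchor X xi a }.

Definition connection_of (delta : L -> A) (xi : L) (a : A) : A :=
  delta (a *: xi).

Definition flat_character (delta : L -> A) : Prop :=
  forall xi zeta, - anchor X xi (delta zeta) + anchor X zeta (delta xi)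
                  + delta (bracket X xi zeta) = 0.

Inductive uterm : Type :=
| UA of A
| UL of L
| UZero
| UOne
| UAdd of uterm & uterm
| UOpp of uterm
| UMul of uterm & uterm.

Inductive urel : uterm -> uterm -> Prop :=
| UrAddl s s' t : urel s s' -> urel (UAdd s t) (UAdd s' t)
| UrAddr s t t' : urel t t' -> urel (UAdd s t) (UAdd s t')
| UrOpp s s' : urel s s' -> urel (UOpp s) (UOpp s')
| UrMull s s' t : urel s s' -> urel (UMul s t) (UMul s' t)
| UrMulr s t t' : urel t t' -> urel (UMul s t) (UMul s t')
| UrAddA s t u : urel (UAdd s (UAdd t u)) (UAdd (UAdd s t) u)
| UrAddC s t : urel (UAdd s t) (UAdd t s)
| UrAdd0 s : urel (UAdd UZero s) s
| UrAddN s : urel (UAdd (UOpp s) s) UZero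
| UrMulA s t u : urel (UMul s (UMul t u)) (UMul (UMul s t) u)
| UrMul1l s : urel (UMul UOne s) s
| UrMul1r s : urel (UMul s UOne) s
| UrMulDl s t u : urel (UMul (UAdd s t) u) (UAdd (UMul s u) (UMul t u))
| UrMulDr s t u : urel (UMul s (UAdd t u)) (UAdd (UMul s t) (UMul s u))
| UrAD a b : urel (UA (a + b)) (UAdd (UA a) (UA b))
| UrA1 : urel (UA 1) UOne
| UrAM a b : urel (UA (a * b)) (UMul (UA a) (UA b))
| UrLD xi zeta : urel (UL (xi + zeta)) (UAdd (UL xi) (UL zeta))
| UrLB xi zeta : urel (UL (bracket X xi zeta))
    (UAdd (UMul (UL xi) (UL zeta)) (UOpp (UMul (UL zeta) (UL xi))))
| UrLA xi a : urel (UAdd (UMul (UL xi) (UA a)) (UOpp (UMul (UA a) (UL xi))))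
    (UA (anchor X xi a))
| UrAL a xi : urel (UMul (UA a) (UL xi)) (UL (a *: xi)).

(* k acts on uenv through k -> A -> uenv, so that the k-algebra structure, the
   k-linearity of uA and that of uL need no further relation.                 *)
Definition uenv : Type := quo urel.
HB.instance Definition _ := Choice.on uenv.

Definition ucls (t : uterm) : uenv := cls urel t.

Lemma ucls_eq s t : urel s t -> ucls s = ucls t.
Proof. exact: cls_eq. Qed.

Lemma uenvW (P : uenv -> Prop) : (forall t, P (ucls t)) -> forall x, P x.
Proof. exact: quoW. Qed.

Definition uadd (x y : uenv) : uenv := ucls (UAdd (rep x) (rep y)).
Definition uopp (x : uenv) : uenv := ucls (UOpp (rep x)).
Definition umul (x y : uenv) : uenv := ucls (UMul (rep x) (rep y)).

Fact uaddE s t : uadd (ucls s) (ucls t) = ucls (UAdd s t).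
Proof.
transitivity (ucls (UAdd s (rep (ucls t)))).
  apply: (@cls_resp _ urel _ (fun u => ucls (UAdd u _))) (repK _).
  by move=> x y h; apply/ucls_eq/UrAddl.
apply: (@cls_resp _ urel _ (fun u => ucls (UAdd _ u))) (repK _).
by move=> x y h; apply/ucls_eq/UrAddr.
Qed.

Fact uoppE s : uopp (ucls s) = ucls (UOpp s).
Proof.
apply: (@cls_resp _ urel _ (fun u => ucls (UOpp u))) (repK _).
by move=> x y h; apply/ucls_eq/UrOpp.
Qed.

Fact umulE s t : umul (ucls s) (ucls t) = ucls (UMul s t).
Proof.
transitivity (ucls (UMul s (rep (ucls t)))).
  apply: (@cls_resp _ urel _ (fun u => ucls (UMul u _))) (repK _).
  by move=> x y h; apply/ucls_eq/UrMull.
apply: (@cls_resp _ urel _ (fun u => ucls (UMul _ u))) (repK _).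
by move=> x y h; apply/ucls_eq/UrMulr.
Qed.

Fact uaddA : associative uadd.
Proof.
elim/uenvW=> s; elim/uenvW=> t; elim/uenvW=> u.
by rewrite !uaddE; apply/ucls_eq/UrAddA.
Qed.
Fact uaddC : commutative uadd.
Proof.
by elim/uenvW=> s; elim/uenvW=> t; rewrite !uaddE; apply/ucls_eq/UrAddC.
Qed.
Fact uadd0 : left_id (ucls UZero) uadd.
Proof. by elim/uenvW=> s; rewrite uaddE; apply/ucls_eq/UrAdd0. Qed.
Fact uaddN : left_inverse (ucls UZero) uopp uadd.
Proof. by elim/uenvW=> s; rewrite uoppE uaddE; apply/ucls_eq/UrAddN. Qed.

HB.instance Definition _ := GRing.isZmodule.Build uenv uaddA uaddC uadd0 uaddN.

Lemma uclsD s t : ucls (UAdd s t) = ucls s + ucls t.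
Proof. by rewrite [RHS]uaddE. Qed.

Lemma uclsN s : ucls (UOpp s) = - ucls s.
Proof. by rewrite [RHS]uoppE. Qed.

Fact umulA : associative umul.
Proof.
elim/uenvW=> s; elim/uenvW=> t; elim/uenvW=> u.
by rewrite !umulE; apply/ucls_eq/UrMulA.
Qed.
Fact umul1l : left_id (ucls UOne) umul.
Proof. by elim/uenvW=> s; rewrite umulE; apply/ucls_eq/UrMul1l. Qed.
Fact umul1r : right_id (ucls UOne) umul.
Proof. by elim/uenvW=> s; rewrite umulE; apply/ucls_eq/UrMul1r. Qed.
Fact umulDl : left_distributive umul +%R.
Proof.
elim/uenvW=> s; elim/uenvW=> t; elim/uenvW=> u.
by rewrite -uclsD !umulE -uclsD; apply/ucls_eq/UrMulDl.
Qed.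
Fact umulDr : right_distributive umul +%R.
Proof.
elim/uenvW=> s; elim/uenvW=> t; elim/uenvW=> u.
by rewrite -uclsD !umulE -uclsD; apply/ucls_eq/UrMulDr.
Qed.

HB.instance Definition _ :=
  GRing.Zmodule_isPzRing.Build uenv umulA umul1l umul1r umulDl umulDr.

Lemma uclsM s t : ucls (UMul s t) = ucls s * ucls t.
Proof. by rewrite [RHS]umulE. Qed.

(* uA is both the source map s and the target map t of uenv *)
Definition uA (a : A) : uenv := ucls (UA a).
Definition uL (xi : L) : uenv := ucls (UL xi).

Lemma uAD a b : uA (a + b) = uA a + uA b.
Proof. by rewrite -uclsD; apply/ucls_eq/UrAD. Qed.

Fact uA_zmod : zmod_morphism uA.
Proof. by move=> a b; apply: (addIr (uA b)); rewrite -uAD !subrK. Qed.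

Fact uA_monoid : monoid_morphism uA.
Proof.
split=> [|a b]; first exact/ucls_eq/UrA1.
by rewrite -uclsM; apply/ucls_eq/UrAM.
Qed.

HB.instance Definition _ := GRing.isZmodMorphism.Build A uenv uA uA_zmod.
HB.instance Definition _ := GRing.isMonoidMorphism.Build A uenv uA uA_monoid.

Lemma uLD xi zeta : uL (xi + zeta) = uL xi + uL zeta.
Proof. by rewrite -uclsD; apply/ucls_eq/UrLD. Qed.

Lemma uL_bracket xi zeta :
  uL (bracket X xi zeta) = uL xi * uL zeta - uL zeta * uL xi.
Proof. by rewrite -!uclsM -uclsN -uclsD; apply/ucls_eq/UrLB. Qed.

Lemma uL_A xi a : uL xi * uA a - uA a * uL xi = uA (anchor X xi a).
Proof. by rewrite -!uclsM -uclsN -uclsD; apply/ucls_eq/UrLA. Qed.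

Lemma uA_L a xi : uA a * uL xi = uL (a *: xi).
Proof. by rewrite -uclsM; apply/ucls_eq/UrAL. Qed.

Lemma uenv_ind (P : uenv -> Prop) :
    (forall a, P (uA a)) -> (forall xi, P (uL xi)) ->
    (forall x y, P x -> P y -> P (x + y)) -> (forall x, P x -> P (- x)) ->
    (forall x y, P x -> P y -> P (x * y)) ->
  forall x, P x.
Proof.
move=> PA PL PD PN PM; elim/uenvW.
elim=> [a|xi|||s IHs t IHt|s IHs|s IHs t IHt]; first exact: PA.
- exact: PL.
- by rewrite (_ : ucls _ = uA 0) // rmorph0.
- by rewrite (_ : ucls _ = uA 1) // rmorph1.
- by rewrite uclsD; apply: PD.
- by rewrite uclsN; apply: PN.
- by rewrite uclsM; apply: PM.
Qed.

Lemma uenv_scale_central c x : uA (kA c) * x = x * uA (kA c).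
Proof.
elim/uenv_ind: x => [a|xi|x y IHx IHy|x IHx|x y IHx IHy].
- by rewrite -!rmorphM mulrC.
- apply/esym/eqP; rewrite -subr_eq0 uL_A -[kA c]mulr1.
  have [_ dZ dM] := anchor_der X xi; rewrite dZ.
  have := dM 1 1; rewrite !(mulr1, mul1r) => D1.
  have -> : anchor X xi 1 = 0 by apply: (addrI (anchor X xi 1)); rewrite addr0.
  by rewrite mulr0 rmorph0.
- by rewrite mulrDl mulrDr IHx IHy.
- by rewrite mulrN mulNr IHx.
- by rewrite mulrA IHx -!mulrA IHy.
Qed.

Section Universal.
Variables (B : pzRingType) (f : {rmorphism A -> B}) (g : L -> B).
Hypothesis gD : forall xi zeta, g (xi + zeta) = g xi + g zeta.
Hypothesis gB : forall xi zeta,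
  g (bracket X xi zeta) = g xi * g zeta - g zeta * g xi.
Hypothesis gA : forall xi a, g xi * f a - f a * g xi = f (anchor X xi a).
Hypothesis gZ : forall a xi, f a * g xi = g (a *: xi).

Fixpoint ueval (t : uterm) : B :=
  match t with
  | UA a => f a
  | UL xi => g xi
  | UZero => 0
  | UOne => 1
  | UAdd s t => ueval s + ueval t
  | UOpp s => - ueval s
  | UMul s t => ueval s * ueval t
  end.

Fact uevalE s t : urel s t -> ueval s = ueval t.
Proof.
elim=> //= {s t}; do ?by move=> s s' t _ ->.
- by move=> s t _ ->.
- by move=> s t u; rewrite addrA.
- by move=> s t; rewrite addrC.
- by move=> s; rewrite add0r.
- by move=> s; rewrite addNr.
- by move=> s t u; rewrite mulrA.
- by move=> s; rewrite mul1r.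
- by move=> s; rewrite mulr1.
- by move=> s t u; rewrite mulrDl.
- by move=> s t u; rewrite mulrDr.
- by move=> a b; rewrite rmorphD.
- by rewrite rmorph1.
- by move=> a b; rewrite rmorphM.
Qed.

Definition ulift (x : uenv) : B := qlift ueval x.

Fact ulift_cls t : ulift (ucls t) = ueval t.
Proof. exact: (qliftE uevalE). Qed.

Lemma uenv_universal :
  exists2 h : {rmorphism uenv -> B},
    (forall a, h (uA a) = f a) /\ (forall xi, h (uL xi) = g xi)
  & forall h' : {rmorphism uenv -> B},
      (forall a, h' (uA a) = f a) -> (forall xi, h' (uL xi) = g xi) -> h' =1 h.
Proof.
have za : zmod_morphism ulift.
  elim/uenvW=> s; elim/uenvW=> t.
  by rewrite -uclsN -uclsD !ulift_cls.
have mm : monoid_morphism ulift.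
  split; first exact: (ulift_cls UOne).
  by elim/uenvW=> s; elim/uenvW=> t; rewrite -uclsM !ulift_cls.
pose h : {rmorphism uenv -> B} := HB.pack ulift
  (GRing.isZmodMorphism.Build uenv B ulift za)
  (GRing.isMonoidMorphism.Build uenv B ulift mm).
have hA a : h (uA a) = f a by exact: (ulift_cls (UA a)).
have hL xi : h (uL xi) = g xi by exact: (ulift_cls (UL xi)).
exists h => // h' h'A h'L.
elim/uenv_ind=> [a|xi|x y IHx IHy|x IHx|x y IHx IHy].
- by rewrite hA h'A.
- by rewrite hL h'L.
- by rewrite !rmorphD IHx IHy.
- by rewrite !rmorphN IHx.
- by rewrite !rmorphM IHx IHy.
Qed.

End Universal.

Definition ulact (a : A) (x : uenv) : uenv := uA a * x.

Definition uenv2 : Type := tens ulact ulact.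
HB.instance Definition _ := GRing.Zmodule.on uenv2.

Definition upure (x y : uenv) : uenv2 := pure ulact ulact x y.

Definition urmul (p q : uenv) (z : uenv2) : uenv2 :=
  tlift (fun u v => upure (u * p) (v * q)) z.

Definition uactA (a : A) (z : uenv2) : uenv2 :=
  tlift (fun u v => upure (uA a * u) v) z.

Definition uactL (xi : L) (z : uenv2) : uenv2 :=
  tlift (fun u v => upure (uL xi * u) v + upure u (uL xi * v)) z.

Lemma upureDl u u' v : upure (u + u') v = upure u v + upure u' v.
Proof. exact: pureDl. Qed.

Lemma upureDr u v v' : upure u (v + v') = upure u v + upure u v'.
Proof. exact: pureDr. Qed.

Lemma upureNl u v : upure (- u) v = - upure u v.
Proof. exact: pureNl. Qed.

Lemma upureNr u v : upure u (- v) = - upure u v.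
Proof. exact: pureNr. Qed.

Lemma upure_bal a u v : upure (uA a * u) v = upure u (uA a * v).
Proof. exact: pure_bal. Qed.

Fact urmul_bal p q :
  balanced ulact ulact (fun u v => upure (u * p) (v * q)).
Proof.
split=> [u u' v|u v v'|a u v].
- by rewrite mulrDl upureDl.
- by rewrite mulrDl upureDr.
- by rewrite /ulact -!mulrA upure_bal.
Qed.

Fact uactA_bal a : balanced ulact ulact (fun u v => upure (uA a * u) v).
Proof.
split=> [u u' v|u v v'|b u v].
- by rewrite mulrDr upureDl.
- by rewrite upureDr.
- by rewrite /ulact mulrA -rmorphM mulrC rmorphM -mulrA; apply: upure_bal.
Qed.

Fact uactL_bal xi : balanced ulact ulact
  (fun u v => upure (uL xi * u) v + upure u (uL xi * v)).
Proof.
split=> [u u' v|u v v'|a u v].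
- by rewrite mulrDr !upureDl addrACA.
- by rewrite mulrDr !upureDr addrACA.
- rewrite /ulact !mulrA.
  have -> : uL xi * uA a = uA a * uL xi + uA (anchor X xi a).
    by rewrite -uL_A addrC subrK.
  rewrite !mulrDl upureDl upureDr -!mulrA !upure_bal.
  by rewrite -!addrA; congr (_ + _); rewrite addrC.
Qed.

Lemma urmul_pure p q u v : urmul p q (upure u v) = upure (u * p) (v * q).
Proof. exact: (tlift_pure (urmul_bal p q)). Qed.

Lemma urmulD p q : {morph urmul p q : x y / x + y}.
Proof. exact: (tliftD (urmul_bal p q)). Qed.

Lemma urmul0 p q : urmul p q 0 = 0.
Proof. exact: (tlift0 (urmul_bal p q)). Qed.

Lemma urmulN p q : {morph urmul p q : x / - x}.
Proof. exact: (tliftN (urmul_bal p q)). Qed.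

Fact uactA_pure a u v : uactA a (upure u v) = upure (uA a * u) v.
Proof. exact: (tlift_pure (uactA_bal a)). Qed.

Fact uactAD a : {morph uactA a : x y / x + y}.
Proof. exact: (tliftD (uactA_bal a)). Qed.

Fact uactL_pure xi u v :
  uactL xi (upure u v) = upure (uL xi * u) v + upure u (uL xi * v).
Proof. exact: (tlift_pure (uactL_bal xi)). Qed.

Fact uactLD xi : {morph uactL xi : x y / x + y}.
Proof. exact: (tliftD (uactL_bal xi)). Qed.

Lemma uenv2_ind (P : uenv2 -> Prop) :
    (forall u v, P (upure u v)) -> (forall x y, P x -> P y -> P (x + y)) ->
  forall x, P x.
Proof. exact: tens_ind. Qed.

(* The left action of uenv on uenv2, i.e. left multiplication by Δ(h): a acts
   as a ⊗ 1 and xi as xi ⊗ 1 + 1 ⊗ xi.                                        *)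
Fixpoint utact (t : uterm) (z : uenv2) : uenv2 :=
  match t with
  | UA a => uactA a z
  | UL xi => uactL xi z
  | UZero => 0
  | UOne => z
  | UAdd s t => utact s z + utact t z
  | UOpp s => - utact s z
  | UMul s t => utact s (utact t z)
  end.

Fact utactD t : {morph utact t : x y / x + y}.
Proof.
elim: t => [a|xi|||s IHs t IHt|s IHs|s IHs t IHt] x y /=.
- exact: uactAD.
- exact: uactLD.
- by rewrite addr0.
- by [].
- by rewrite IHs IHt addrACA.
- by rewrite IHs opprD.
- by rewrite IHt IHs.
Qed.

Fact addr_shuffle (Z : zmodType) (a b c d e f : Z) :
  a - b + (c - d) = (a + e) + (f + c) - ((b + f) + (e + d)).
Proof.
have -> : a + e + (f + c) = a + c + (e + f) by rewrite [f + c]addrC addrACA.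
have -> : b + f + (e + d) = b + d + (e + f).
  by rewrite [e + d]addrC addrACA [f + e]addrC.
by rewrite opprD [RHS]addrACA subrr addr0 opprD [RHS]addrACA.
Qed.

Fact utactE s t : urel s t -> utact s =1 utact t.
Proof.
elim=> {s t}.
- by move=> s s' t _ IH z /=; rewrite IH.
- by move=> s t t' _ IH z /=; rewrite IH.
- by move=> s s' _ IH z /=; rewrite IH.
- by move=> s s' t _ IH z /=; rewrite IH.
- by move=> s t t' _ IH z /=; rewrite IH.
- by move=> s t u z /=; rewrite addrA.
- by move=> s t z /=; rewrite addrC.
- by move=> s z /=; rewrite add0r.
- by move=> s z /=; rewrite addNr.
- by [].
- by [].
- by [].
- by [].
- by move=> s t u z /=; rewrite utactD.
- move=> a b; elim/uenv2_ind=> [u v|x y IHx IHy]; last by rewrite !utactD IHx IHy.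
  by rewrite /= !uactA_pure rmorphD mulrDl upureDl.
- elim/uenv2_ind=> [u v|x y IHx IHy]; last by rewrite !utactD IHx IHy.
  by rewrite /= !uactA_pure rmorph1 mul1r.
- move=> a b; elim/uenv2_ind=> [u v|x y IHx IHy]; last by rewrite !utactD IHx IHy.
  by rewrite /= !uactA_pure rmorphM mulrA.
- move=> xi zeta; elim/uenv2_ind=> [u v|x y IHx IHy].
    by rewrite /= !uactL_pure uLD !mulrDl upureDl upureDr addrACA.
  by rewrite !utactD IHx IHy.
- move=> xi zeta; elim/uenv2_ind=> [u v|x y IHx IHy].
    rewrite /= !(uactL_pure, uactLD) uL_bracket !mulrBl.
    rewrite upureDl upureDr upureNl upureNr !mulrA.
    exact: addr_shuffle.
  by rewrite !utactD IHx IHy.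
- move=> xi a; elim/uenv2_ind=> [u v|x y IHx IHy]; last by rewrite !utactD IHx IHy.
  rewrite /= !(uactL_pure, uactA_pure, uactAD) -uL_A mulrBl upureDl upureNl.
  by rewrite !mulrA opprD addrACA subrr addr0.
- move=> a xi; elim/uenv2_ind=> [u v|x y IHx IHy]; last by rewrite !utactD IHx IHy.
  by rewrite /= !(uactL_pure, uactA_pure, uactAD) -uA_L -!mulrA; congr (_ + _); apply: upure_bal.
Qed.

Definition uact (x : uenv) (z : uenv2) : uenv2 :=
  qlift (fun t => utact t z) x.

Fact uact_cls t z : uact (ucls t) z = utact t z.
Proof. by apply: (@qliftE _ urel) => s s' h; apply: utactE. Qed.

Definition coprod (x : uenv) : uenv2 := uact x (upure 1 1).

(* V ⊗_A V is not a ring, so multiplicativity is stated on representatives: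
   (∑ u ⊗ v)(∑ u' ⊗ v') = ∑ uu' ⊗ vv'.                                        *)
Record is_coproduct (D : uenv -> uenv2) : Prop := IsCoproduct {
  coprodD : forall x y, D (x + y) = D x + D y;
  coprodA : forall a, D (uA a) = upure (uA a) 1;
  coprodL : forall xi, D (uL xi) = upure (uL xi) 1 + upure 1 (uL xi);
  coprodM : forall x y (s t : seq (uenv * uenv)),
    D x = \sum_(p <- s) upure p.1 p.2 -> D y = \sum_(q <- t) upure q.1 q.2 ->
    D (x * y) = \sum_(p <- s) \sum_(q <- t) upure (p.1 * q.1) (p.2 * q.2) }.

Lemma uactDl x y z : uact (x + y) z = uact x z + uact y z.
Proof.
by elim/uenvW: x => s; elim/uenvW: y => t; rewrite -uclsD !uact_cls.
Qed.

Lemma uactDr x : {morph uact x : y z / y + z}.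
Proof. by elim/uenvW: x => s y z; rewrite !uact_cls utactD. Qed.

Lemma uactM x y z : uact (x * y) z = uact x (uact y z).
Proof.
by elim/uenvW: x => s; elim/uenvW: y => t; rewrite -uclsM !uact_cls.
Qed.

Lemma uact_urmul x p q z : uact x (urmul p q z) = urmul p q (uact x z).
Proof.
elim/uenvW: x => t; rewrite !uact_cls.
elim: t z => [a|xi|||s IHs t IHt|s IHs|s IHs t IHt] z /=.
- elim/uenv2_ind: z => [u v|x y IHx IHy]; last by rewrite !(urmulD, uactAD) IHx IHy.
  by rewrite !(urmul_pure, uactA_pure) mulrA.
- elim/uenv2_ind: z => [u v|x y IHx IHy]; last by rewrite !(urmulD, uactLD) IHx IHy.
  by rewrite !(urmul_pure, uactL_pure, urmulD) !mulrA.
- by rewrite urmul0.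
- by [].
- by rewrite IHs IHt urmulD.
- by rewrite IHs urmulN.
- by rewrite IHt IHs.
Qed.

Lemma coprodP : is_coproduct coprod.
Proof.
split=> [x y|a|xi|x y s t Dx Dy].
- exact: uactDl.
- by rewrite /coprod [uact _ _]uact_cls /= uactA_pure mulr1.
- by rewrite /coprod [uact _ _]uact_cls /= uactL_pure !mulr1.
have act0 z : uact z 0 = 0.
  by apply: (addrI (uact z 0)); rewrite -uactDr !addr0.
rewrite exchange_big /= /coprod uactM -/(coprod y) Dy.
rewrite (big_morph _ (uactDr x) (act0 x)); apply: eq_bigr => q _.
rewrite -{1}[q.1]mul1r -{1}[q.2]mul1r -urmul_pure uact_urmul -/(coprod x) Dx.
rewrite (big_morph _ (urmulD q.1 q.2) (urmul0 _ _)); apply: eq_bigr => p _.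
by rewrite urmul_pure.
Qed.

Lemma coprod_uniq D : is_coproduct D -> D =1 coprod.
Proof.
move=> [DD DA DL DM] x; have [cD cA cL cM] := coprodP.
have D0 : D 0 = 0 by apply: (addrI (D 0)); rewrite -DD !addr0.
have c0 : coprod 0 = 0 by apply: (addrI (coprod 0)); rewrite -cD !addr0.
elim/uenv_ind: x => [a|xi|x y IHx IHy|x IHx|x y IHx IHy].
- by rewrite DA cA.
- by rewrite DL cL.
- by rewrite DD cD IHx IHy.
- by apply: (addrI (D x)); rewrite -DD subrr D0 IHx -cD subrr c0.
- have [s hs] := tens_sum (coprod x); have [t ht] := tens_sum (coprod y).
  by rewrite (cM _ _ s t hs ht); apply: DM; rewrite ?IHx ?IHy.
Qed.

(* For Δ(h) = ∑ u ⊗ v, the left-hand sides of the two identities read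
   ∑ S(u)_(1') v ⊗ S(u)_(2')  and  ∑ S^-1(v)_(1') ⊗ S^-1(v)_(2') u.           *)
Record is_antipode (S Sinv : uenv -> uenv) : Prop := IsAntipode {
  antipK : cancel S Sinv;
  antipVK : cancel Sinv S;
  antipD : forall x y, S (x + y) = S x + S y;
  antipZ : forall c x, S (uA (kA c) * x) = uA (kA c) * S x;
  antip1 : S 1 = 1;
  antipM : forall x y, S (x * y) = S y * S x;
  antip_target : forall a, S (uA a) = uA a;
  antip_left : forall h (s : seq (uenv * uenv)),
    coprod h = \sum_(p <- s) upure p.1 p.2 ->
    \sum_(p <- s) urmul p.2 1 (coprod (S p.1)) = upure 1 (S h);
  antip_right : forall h (s : seq (uenv * uenv)),
    coprod h = \sum_(p <- s) upure p.1 p.2 ->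
    \sum_(p <- s) urmul 1 p.1 (coprod (Sinv p.2)) = upure (Sinv h) 1 }.

Definition admits_antipode : Prop := exists S Sinv, is_antipode S Sinv.

End Enveloping.
End KAlgebra.

(* Main.v *)
From HB Require Import structures.
Require Import Defs.
From mathcomp Require Import all_boot all_algebra ring.
Set Implicit Arguments.
Unset Strict Implicit.
Unset Printing Implicit Defensive.
Import GRing.Theory.
Local Open Scope ring_scope.

(** Every map to be constructed out of the jet space is prescribed on the
    elements a *: jet1 b by a biadditive expression F a b, so everything hinges
    on knowing when such an F descends to (A ⊗ A) / I^2.  It does exactly when F
    kills c (da)(db) with da = 1 ⊗ a - a ⊗ 1, that is, when b |-> F a b satisfies
    the identity of a first-order differential operator, with the multiplier
    moved into the left slot ([jet_balanced], [jlift_gen]).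

    In a Jacobi algebra both {a, -} and the Hamiltonian operators Φ_a are of
    first order, Φ_a is moreover a derivation, and a |-> Φ_a is again of first
    order.  Hence the anchor, the character a j(b) |-> {a, b}, and the operators
    ad_f (b j(g)) = b j{f, g} + Φ_f(b) j(g) exist on jets; the bracket arises by
    lifting once more, in its first argument.  The expressions measuring the
    failure of the Jacobi identity and of flatness of the character are
    A-multilinear by the Leibniz rules, so they vanish as soon as they vanish on
    the elements jet1 f, where both are the Jacobi identity of J
    ([jet_jacobiator0], [jet_character_flat]).

    The remaining statements hold for any Lie-Rinehart algebra with a right
    character δ.  The curvature of the associated connection is the curvature of
    δ times the argument ([connection_curvature]), so flatness passes from one to
    the other.  If δ is flat, S(a) = a and S(ξ) = δ(ξ) - ξ respect the relations
    of the enveloping algebra V with reversed product: the Leibniz rule for δ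
    gives aξ, flatness gives [ξ, ζ].  So S exists by the universal property, and
    S^2 = 1 on generators.  The first antipode identity is stable under products
    and is checked on generators ([contraction_coprod]); the second is its mirror
    image, because V is cocommutative ([uflip_coprod]) and S is its own
    inverse.  *)

(** * Deciding linear identities in modules over commutative rings *)

Section ModuleExpressions.
Variables (A : comPzRingType) (M : lmodType A).

(** Syntax of module terms; two of them agree in every module as soon as they
    have the same coefficient at each variable.  This turns identities in the
    jet module into finitely many ring identities for [ring]. *)
Inductive mexp : Type :=
| MVar of nat
| MZero
| MAdd of mexp & mexp
| MOpp of mexp
| MScale of A & mexp.

Fixpoint meval (env : seq M) (e : mexp) : M :=
  match e with
  | MVar j => env`_j
  | MZero => 0
  | MAdd e1 e2 => meval env e1 + meval env e2
  | MOpp e1 => - meval env e1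
  | MScale a e1 => a *: meval env e1
  end.

Fixpoint mcoef (i : nat) (e : mexp) : A :=
  match e with
  | MVar j => if eqn j i then 1 else 0
  | MZero => 0
  | MAdd e1 e2 => mcoef i e1 + mcoef i e2
  | MOpp e1 => - mcoef i e1
  | MScale a e1 => a * mcoef i e1
  end.

Lemma meval_coef env e :
  meval env e = \sum_(i <- iota 0 (size env)) mcoef i e *: env`_i.
Proof.
elim: e => /= [j||e1 -> e2 ->|e1 ->|a e1 ->].
- have [lt_j|le_j] := ltnP j (size env).
    rewrite (bigD1_seq j) ?mem_iota ?iota_uniq //= eqnE eqxx scale1r.
    rewrite big1 ?addr0 //.
    by move=> i; rewrite eq_sym => /negPf ->; rewrite scale0r.
  rewrite nth_default // big1_seq // => i /andP[_].
  rewrite mem_iota add0n => lt_i.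
  by rewrite eqnE gtn_eqF ?scale0r // (leq_trans lt_i le_j).
- by rewrite big1 // => i _; rewrite scale0r.
- by rewrite -big_split; apply: eq_bigr => i _; rewrite scalerDl.
- by rewrite -sumrN; apply: eq_bigr => i _; rewrite scaleNr.
- by rewrite scaler_sumr; apply: eq_bigr => i _; rewrite scalerA.
Qed.

Lemma meval_eq env e1 e2 :
    foldr (fun i P => mcoef i e1 = mcoef i e2 /\ P) True (iota 0 (size env)) ->
  meval env e1 = meval env e2.
Proof.
rewrite !meval_coef; elim: (iota 0 _) => [|i s IHs] /=.
  by rewrite !big_nil.
by case=> e_i /IHs e_s; rewrite !big_cons e_i e_s.
Qed.

End ModuleExpressions.

Ltac add_atom x env :=
  lazymatch env with
  | context [cons x _] => env
  | _ => constr:(cons x env)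
  end.

Ltac atoms t env :=
  lazymatch t with
  | (?t1 + ?t2)%R => let env := atoms t1 env in atoms t2 env
  | (- ?t1)%R => atoms t1 env
  | (_ *: ?t1)%R => atoms t1 env
  | 0%R => env
  | _ => add_atom t env
  end.

Ltac atom_index x env :=
  lazymatch env with
  | cons x _ => constr:(O)
  | cons _ ?env' => let i := atom_index x env' in constr:(S i)
  end.

Ltac reify A t env :=
  lazymatch t with
  | (?t1 + ?t2)%R =>
      let e1 := reify A t1 env in let e2 := reify A t2 env in
      constr:(MAdd e1 e2)
  | (- ?t1)%R => let e1 := reify A t1 env in constr:(MOpp e1)
  | (?a *: ?t1)%R => let e1 := reify A t1 env in constr:(MScale a e1)
  | 0%R => constr:(MZero A)
  | _ => let i := atom_index t env in constr:(MVar A i)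
  end.

(** The argument A is the ring of scalars. Maximal subterms other than sums,
    opposites, scalings and 0 are treated as variables. *)
Ltac module A :=
  lazymatch goal with
  | |- @eq ?T ?t1 ?t2 =>
      let env := atoms t1 (@nil T) in
      let env := atoms t2 env in
      let e1 := reify A t1 env in
      let e2 := reify A t2 env in
      change (meval env e1 = meval env e2);
      apply: meval_eq; cbn [size iota foldr mcoef eqn];
      repeat (split; first by ring); exact: I
  end.

(** * The universal property of the jet space *)

Section Jets.
Variables (k : fieldType) (A : comPzRingType) (kA : {rmorphism k -> A}).
Local Notation j1 := (jet1 kA).

Lemma jet_ind (Q : jet kA -> Prop) :
    (forall a b, Q (a *: j1 b)) -> (forall x y, Q x -> Q y -> Q (x + y)) ->
  forall x, Q x.
Proof.
move=> Qg QD; elim/jetW; elim/tens_ind=> [a b|x y Qx Qy].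
  by rewrite jet_pure.
by rewrite jet_projD; apply: QD.
Qed.

Lemma jet_span_ind (Q : jet kA -> Prop) :
    (forall b, Q (j1 b)) -> (forall a x, Q x -> Q (a *: x)) ->
    (forall x y, Q x -> Q y -> Q (x + y)) ->
  forall x, Q x.
Proof. by move=> Qg QZ; apply: jet_ind => a b; apply: QZ. Qed.

Lemma jet1D a b : j1 (a + b) = j1 a + j1 b.
Proof. by rewrite -jet_projD /jet1 /pureA pureDr. Qed.

Lemma jet1_0 : j1 0 = 0.
Proof. by apply: (addrI (j1 0)); rewrite -jet1D !addr0. Qed.

Lemma jet1N a : j1 (- a) = - j1 a.
Proof. by apply: (addrI (j1 a)); rewrite -jet1D !subrr jet1_0. Qed.

Lemma jet1Z c a : j1 (kA c * a) = kA c *: j1 a.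
Proof.
rewrite -jet_pure /jet1 /pureA -[kA c * a]/(kscale kA c a).
by rewrite -(pure_bal (kscale kA) (kscale kA)) /kscale mulr1.
Qed.

Lemma multAD (x y : tensA kA) : multA (x + y) = multA x + multA y.
Proof. exact: tliftD (mult_bal kA) _ _. Qed.

(** The condition for a *: jet1 b |-> F a b to be well defined on the jet space;
    [jbalM] says that F vanishes on the elements a (db)(dc), which span I^2.
    F need not be A-linear in its first argument, as the bracket of jets
    demands. *)
Record jet_balanced (P : zmodType) (F : A -> A -> P) : Prop := JetBalanced {
  jbalDl : forall a a' b, F (a + a') b = F a b + F a' b;
  jbalDr : forall a b b', F a (b + b') = F a b + F a b';
  jbalZ : forall c a b, F (kA c * a) b = F a (kA c * b);
  jbalM : forall a b c,
    F a (b * c) = F (a * b) c + F (a * c) b - F (a * b * c) 1 }.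

Section Lift.
Variables (P : zmodType) (F : A -> A -> P).
Hypothesis jbalF : jet_balanced F.

Let balF : balanced (kscale kA) (kscale kA) F.
Proof. by case: jbalF => Dl Dr Z _; split. Qed.

Let tF : tensA kA -> P := tlift F.
Let tFD x y : tF (x + y) = tF x + tF y. Proof. exact: tliftD. Qed.
Let tFN x : tF (- x) = - tF x. Proof. exact: tliftN. Qed.
Let tFE a b : tF (pureA kA a b) = F a b. Proof. exact: tlift_pure. Qed.

(** Unlike vanishing on I^2, which involves elements known only through their
    image under multiplication, this identity is biadditive in x and y, so it
    suffices to check it on pure tensors, where it is [jbalM]. *)
Lemma jet_balanced_mul x y :
  tF (x * y) = tF (pureA kA (multA x) 1 * y) + tF (pureA kA (multA y) 1 * x)
               - tF (pureA kA (multA x * multA y) 1).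
Proof.
have pD a b : pureA kA (a + b) 1 = pureA kA a 1 + pureA kA b 1.
  exact: pureDl.
elim/tens_ind: x => [a b|x x' IHx IHx'].
  elim/tens_ind: y => [c d|y y' IHy IHy'].
    rewrite !pureAM !multA_pure !tFE.
    rewrite (jbalM jbalF) !mul1r.
    by congr (F _ _ + F _ _ - F _ _); ring.
  by rewrite multAD !(mulrDr, pD, mulrDl, tFD) IHy IHy' opprD addrACA;
    congr (_ + _); rewrite addrACA.
by rewrite multAD !(mulrDr, pD, mulrDl, tFD) IHx IHx' opprD addrACA;
    congr (_ + _); rewrite addrACA.
Qed.

Lemma jet_balanced_kerI2 x : kerI2 x -> tF x = 0.
Proof.
have tF0 : tF 0 = 0 by exact: tlift0.
have p0 : pureA kA 0 1 = 0 by exact: pure0l.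
move=> [s Is ->]; rewrite (big_morph tF tFD tF0) big1_seq //.
move=> p /andP[_ /Is[]].
rewrite /kerI => Ip1 Ip2.
by rewrite jet_balanced_mul Ip1 Ip2 mul0r p0 !mul0r tF0 subr0 addr0.
Qed.

Definition jlift (x : jet kA) : P := tF (rep x).

Lemma jlift_proj x : jlift (jet_proj x) = tF x.
Proof.
apply/eqP; rewrite -subr_eq0 -tFN -tFD; apply/eqP/jet_balanced_kerI2.
exact: rep_proj.
Qed.

Lemma jlift_gen a b : jlift (a *: j1 b) = F a b.
Proof. by rewrite -jet_pure jlift_proj tFE. Qed.

Lemma jliftD x y : jlift (x + y) = jlift x + jlift y.
Proof.
by elim/jetW: x => x; elim/jetW: y => y; rewrite -jet_projD !jlift_proj.
Qed.

End Lift.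

(** The difference of the two sides is the class of (da)(db), with
    da = 1 ⊗ a - a ⊗ 1 in I. *)
Lemma jet1M a b : j1 (a * b) = a *: j1 b + b *: j1 a - (a * b) *: j1 1.
Proof.
have mB c : multA (pureA kA 1 c - pureA kA c 1) = 0.
  by rewrite -[- pureA kA c 1]pureNl multAD !multA_pure mul1r mulr1 subrr.
pose d c := pureA kA 1 c - pureA kA c 1.
have projN x : - jet_proj x = jet_proj (- x) := joppE x.
rewrite -!jet_pure /jet1 projN -(jet_projD (pureA kA a b)) -jet_projD.
apply/jet_projE; exists [:: (d a, d b)].
  by move=> p; rewrite inE => /eqP ->; split; apply: mB.
rewrite big_seq1 /= /d mulrBl !mulrBr !pureAM !mul1r !mulr1.
by ring.
Qed.

End Jets.

(** * The enveloping algebra and its coproduct *)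

(** The computation behind [antipodeL_bracket]: p and q stand for values of the
    character, x and z for elements of the Lie-Rinehart algebra. *)
Lemma commutator_subr (B : pzRingType) (p q x z : B) : p * q = q * p ->
  (q - z) * (p - x) - (p - x) * (q - z) =
  (x * q - q * x) - (z * p - p * z) - (x * z - z * x).
Proof.
move=> pq; rewrite !(mulrBl, mulrBr) !opprB !addrA pq.
by rewrite [LHS](ACl (1 * 8 * 5 * 2 * 7 * 4 * 3 * 6))%AC /= subrr add0r.
Qed.

Section EnvelopingAlgebra.
Variables (k : fieldType) (A : comPzRingType) (kA : {rmorphism k -> A}).
Variables (L : lmodType A) (X : lieRinehart kA L).
Local Notation rho := (anchor X).
Local Notation br := (bracket X).
Local Notation V := (uenv X).
Local Notation uA := (uA X).
Local Notation uL := (uL X).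
Local Notation D := (@coprod k A kA L X).

Lemma bracket_anti xi zeta : br xi zeta = - br zeta xi.
Proof.
have lieX := bracket_lie X.
have := lie_alt lieX (xi + zeta).
rewrite (lieDl lieX) !(lieDr lieX) !(lie_alt lieX) add0r addr0.
by move/eqP; rewrite addr_eq0 => /eqP.
Qed.

Lemma anchorN xi a : rho xi (- a) = - rho xi a.
Proof.
have dD := derD (anchor_der X xi).
have d0 : rho xi 0 = 0 by apply: (addrI (rho xi 0)); rewrite -dD !addr0.
by apply: (addrI (rho xi a)); rewrite -dD !subrr d0.
Qed.

Lemma uL_uA xi a : uL xi * uA a = uA a * uL xi + uA (rho xi a).
Proof. by rewrite -uL_A addrC subrK. Qed.

(** The image of A is commutative, so A also maps to the converse ring of V;
    this is what the universal property needs to produce an anti-homomorphism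
    of V. *)
Lemma uA_converse_zmod : zmod_morphism (uA : A -> V^c).
Proof. exact: uA_zmod. Qed.

Lemma uA_converse_monoid : monoid_morphism (uA : A -> V^c).
Proof.
have [uA1 uAM] := uA_monoid X.
by split=> // a b; rewrite mulrC; apply: uAM.
Qed.

Lemma coprodM_uact x y : D (x * y) = uact x (D y).
Proof. exact: uactM. Qed.

Lemma upure_uA a : upure (uA a) 1 = upure 1 (uA a) :> uenv2 X.
Proof. by rewrite -[uA a in LHS]mulr1 upure_bal mulr1. Qed.

Lemma coprod_uAl x a : D (x * uA a) = urmul (uA a) 1 (D x).
Proof.
rewrite coprodM_uact (coprodA (coprodP X)) -uact_urmul urmul_pure.
by rewrite mul1r mulr1.
Qed.

Lemma urmulM (p q p' q' : V) (z : uenv2 X) :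
  urmul p' q' (urmul p q z) = urmul (p * p') (q * q') z.
Proof.
elim/uenv2_ind: z => [u v|x y IHx IHy]; last by rewrite !urmulD IHx IHy.
by rewrite !urmul_pure !mulrA.
Qed.

Lemma urmulDl (p p' q : V) (z : uenv2 X) :
  urmul (p + p') q z = urmul p q z + urmul p' q z.
Proof.
elim/uenv2_ind: z => [u v|x y IHx IHy]; last by rewrite !urmulD IHx IHy addrACA.
by rewrite !urmul_pure mulrDr upureDl.
Qed.

Lemma urmul11 (z : uenv2 X) : urmul 1 1 z = z.
Proof.
elim/uenv2_ind: z => [u v|x y IHx IHy]; last by rewrite urmulD IHx IHy.
by rewrite urmul_pure !mulr1.
Qed.

Lemma coprod1 : D 1 = upure 1 1.
Proof. by rewrite -[1 in LHS](rmorph1 uA) (coprodA (coprodP X)) rmorph1. Qed.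

Lemma coprod0 : D 0 = 0.
Proof. by apply: (addrI (D 0)); rewrite -(coprodD (coprodP X)) !addr0. Qed.

Lemma coprodN x : D (- x) = - D x.
Proof.
by apply: (addrI (D x)); rewrite -(coprodD (coprodP X)) !subrr coprod0.
Qed.

Lemma uact_sum x I (s : seq I) (F : I -> uenv2 X) :
  uact x (\sum_(i <- s) F i) = \sum_(i <- s) uact x (F i).
Proof.
apply: (big_morph _ (@uactDr _ _ _ _ _ x)).
by apply: (addrI (uact x 0)); rewrite -uactDr !addr0.
Qed.

Lemma urmul_sum (p q : V) I (s : seq I) (F : I -> uenv2 X) :
  urmul p q (\sum_(i <- s) F i) = \sum_(i <- s) urmul p q (F i).
Proof. exact: (big_morph _ (urmulD p q) (urmul0 p q)). Qed.

(** Well defined because both tensor factors carry the same left A-action. *)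
Definition uflip (z : uenv2 X) : uenv2 X := tlift (fun u v => upure v u) z.

Lemma uflip_bal : balanced (@ulact _ _ _ _ X) (@ulact _ _ _ _ X)
  (fun u v => upure v u).
Proof.
split=> [u u' v|u v v'|a u v]; [exact: upureDr|exact: upureDl|].
exact/esym/upure_bal.
Qed.

Lemma uflip_pure u v : uflip (upure u v) = upure v u.
Proof. exact: (tlift_pure uflip_bal). Qed.

Lemma uflipD : {morph uflip : y z / y + z}.
Proof. exact: (tliftD uflip_bal). Qed.

Lemma uflip_sum I (s : seq I) (F : I -> uenv2 X) :
  uflip (\sum_(i <- s) F i) = \sum_(i <- s) uflip (F i).
Proof. exact: (big_morph _ uflipD (tlift0 uflip_bal)). Qed.

Lemma uflipK : involutive uflip.
Proof.
elim/uenv2_ind=> [u v|y z IHy IHz]; last by rewrite !uflipD IHy IHz.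
by rewrite !uflip_pure.
Qed.

Lemma uflip_urmul p q z : uflip (urmul p q z) = urmul q p (uflip z).
Proof.
elim/uenv2_ind: z => [u v|x y IHx IHy]; last first.
  by rewrite !(urmulD, uflipD) IHx IHy.
by rewrite !(urmul_pure, uflip_pure).
Qed.

(** Cocommutativity: the flipped coproduct obeys the same defining rules on
    generators and products, and these determine the coproduct. *)
Lemma uflip_coprod h : uflip (D h) = D h.
Proof.
have [cD cA cL cM] := coprodP X.
apply: (@coprod_uniq _ _ _ _ _ (uflip \o D)).
split=> [x y|a|xi|x y s t hs ht] /=.
- by rewrite cD uflipD.
- by rewrite cA uflip_pure upure_uA.
- by rewrite cL uflipD !uflip_pure addrC.
have flip_eq z (r : seq (V * V)) : uflip (D z) = \sum_(p <- r) upure p.1 p.2 ->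
    D z = \sum_(p <- [seq (p.2, p.1) | p <- r]) upure p.1 p.2.
  move=> hr; rewrite -[D z]uflipK hr uflip_sum big_map.
  by apply: eq_bigr => p _; rewrite uflip_pure.
rewrite (cM _ _ _ _ (flip_eq _ _ hs) (flip_eq _ _ ht)) uflip_sum big_map.
apply: eq_bigr => p _; rewrite uflip_sum big_map.
by apply: eq_bigr => q _; rewrite uflip_pure.
Qed.

End EnvelopingAlgebra.

(** * Flat right characters and antipodes *)

Section RightCharacters.
Variables (k : fieldType) (A : comPzRingType) (kA : {rmorphism k -> A}).
Variables (L : lmodType A) (X : lieRinehart kA L).
Variables (delta : L -> A) (charD : right_character X delta).
Local Notation rho := (anchor X).
Local Notation br := (bracket X).

Lemma character0 : delta 0 = 0.
Proof. by apply: (addrI (delta 0)); rewrite -(rchD charD) !addr0. Qed.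

Lemma characterN xi : delta (- xi) = - delta xi.
Proof.
by apply: (addrI (delta xi)); rewrite -(rchD charD) !subrr character0.
Qed.

Definition curvature xi zeta : A :=
  - rho xi (delta zeta) + rho zeta (delta xi) + delta (br xi zeta).

Lemma curvature_anti xi zeta : curvature xi zeta = - curvature zeta xi.
Proof. by rewrite /curvature (bracket_anti X xi) characterN; ring. Qed.

Lemma curvatureD xi zeta zeta' :
  curvature xi (zeta + zeta') = curvature xi zeta + curvature xi zeta'.
Proof.
rewrite /curvature (lieDr (bracket_lie X)) !(rchD charD) anchorD.
by rewrite (derD (anchor_der X xi)); ring.
Qed.

(** In the expansion, the second-order terms in a cancel because the anchor
    respects brackets. *)
Lemma curvatureZ a xi zeta : curvature xi (a *: zeta) = a * curvature xi zeta.
Proof.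
have [dD _ dM] := anchor_der X xi.
rewrite /curvature bracket_leibniz (rchD charD) !(rchM charD) anchorZ.
by rewrite dD anchorN dM anchor_bracket; ring.
Qed.

Lemma right_character_connection : right_connection X (connection_of delta).
Proof.
split; rewrite /connection_of.
- by move=> xi zeta a; rewrite scalerDr (rchD charD).
- by move=> xi a b; rewrite scalerDl (rchD charD).
- by move=> c xi a; rewrite scalerA mulrC -scalerA (rchZ charD).
- by move=> c xi a; rewrite -scalerA (rchZ charD).
- by move=> xi a b; rewrite scalerA mulrC.
- by move=> xi a b; rewrite -scalerA (rchM charD) anchorZ; ring.
Qed.

Lemma connection_curvature xi zeta a :
  connection_of delta xi (connection_of delta zeta a)
  - connection_of delta zeta (connection_of delta xi a)
  + connection_of delta (br xi zeta) a = a * curvature xi zeta.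
Proof.
have [dD _ dM] := anchor_der X xi; have [dD' _ dM'] := anchor_der X zeta.
rewrite /connection_of /curvature !(rchM charD) anchor_bracket.
by rewrite dD dD' !anchorN dM dM'; ring.
Qed.

Lemma flat_character_connection :
  flat_character X delta -> flat_connection X (connection_of delta).
Proof.
move=> flatD xi zeta a; rewrite connection_curvature.
by rewrite [curvature _ _](flatD xi zeta) mulr0.
Qed.

Section Antipode.
Hypothesis flatD : flat_character X delta.
Local Notation V := (uenv X).
Local Notation uA := (uA X).
Local Notation uL := (uL X).
Local Notation D := (@coprod k A kA L X).

(** The restriction of the antipode to the Lie-Rinehart algebra. The term
    δ(ξ) makes ξ |-> δ(ξ) - ξ A-linear for right multiplication by A, which
    ξ |-> - ξ is not. *)
Definition antipodeL xi : V := uA (delta xi) - uL xi.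

Lemma antipodeLD xi zeta :
  antipodeL (xi + zeta) = antipodeL xi + antipodeL zeta.
Proof. by rewrite /antipodeL (rchD charD) uAD uLD opprD addrACA. Qed.

Lemma antipodeLZ a xi : antipodeL xi * uA a = antipodeL (a *: xi).
Proof.
rewrite /antipodeL mulrBl uL_uA -rmorphM (rchM charD) rmorphB opprD addrA.
rewrite addrAC.
by rewrite uA_L mulrC.
Qed.

Lemma antipodeL_anchor xi a :
  uA a * antipodeL xi - antipodeL xi * uA a = uA (rho xi a).
Proof.
rewrite /antipodeL mulrBl mulrBr uL_uA -!rmorphM mulrC opprB addrC.
by rewrite addrA subrK addrC addKr.
Qed.

(** Here the flatness of δ enters: the commutators of δ(ξ) and δ(ζ) with the
    other generator contribute ρ(ξ)(δ(ζ)) - ρ(ζ)(δ(ξ)), which must be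
    δ([ξ, ζ]). *)
Lemma antipodeL_bracket xi zeta :
  antipodeL (br xi zeta) =
    antipodeL zeta * antipodeL xi - antipodeL xi * antipodeL zeta.
Proof.
have -> : antipodeL (br xi zeta) =
    uA (rho xi (delta zeta)) - uA (rho zeta (delta xi)) - uL (br xi zeta).
  rewrite /antipodeL -rmorphB; congr (uA _ - _).
  have := flatD xi zeta; rewrite addrC => /eqP; rewrite addr_eq0 => /eqP ->.
  by ring.
rewrite uL_bracket -!uL_A [RHS]commutator_subr //.
by rewrite -!rmorphM mulrC.
Qed.

(** The universal property of V, applied to the converse ring V^c. *)
Lemma antipode_exists : exists S : V -> V,
  [/\ {morph S : x y / x + y}, S 1 = 1, forall x y, S (x * y) = S y * S x,
      forall a, S (uA a) = uA a & forall xi, S (uL xi) = antipodeL xi].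
Proof.
pose f : {rmorphism A -> V^c} := HB.pack (uA : A -> V^c)
  (GRing.isZmodMorphism.Build A V^c (uA : A -> V^c) (uA_converse_zmod X))
  (GRing.isMonoidMorphism.Build A V^c (uA : A -> V^c) (uA_converse_monoid X)).
have [S [SA SL] _] := @uenv_universal _ _ _ _ X V^c f antipodeL
  antipodeLD antipodeL_bracket antipodeL_anchor antipodeLZ.
exists S; split=> // [x y||x y].
- exact: (rmorphD S).
- exact: (rmorph1 S).
- exact: (rmorphM S).
Qed.

Section AntipodeIdentities.
Variable S : V -> V.
Hypothesis SD : {morph S : x y / x + y}.
Hypothesis S1 : S 1 = 1.
Hypothesis SM : forall x y, S (x * y) = S y * S x.
Hypothesis SA : forall a, S (uA a) = uA a.
Hypothesis SL : forall xi, S (uL xi) = antipodeL xi.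

Lemma antipode0 : S 0 = 0.
Proof. by apply: (addrI (S 0)); rewrite -SD !addr0. Qed.

Lemma antipodeN x : S (- x) = - S x.
Proof. by apply: (addrI (S x)); rewrite -SD !subrr antipode0. Qed.

(** S(S(ξ)) = S(δ(ξ)) - S(ξ) = δ(ξ) - (δ(ξ) - ξ). *)
Lemma antipodeK : involutive S.
Proof.
elim/uenv_ind=> [a|xi|x y IHx IHy|x IHx|x y IHx IHy].
- by rewrite !SA.
- by rewrite SL SD antipodeN SA SL /antipodeL opprB addrC subrK.
- by rewrite !SD IHx IHy.
- by rewrite !antipodeN IHx.
- by rewrite !SM IHx IHy.
Qed.

(** The map u ⊗ v |-> S(u)_(1) v ⊗ S(u)_(2). That it is defined on the tensor
    product over A lets the first antipode identity be stated about the
    coproduct itself, independently of how it is written as a sum. *)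
Definition contraction (z : uenv2 X) : uenv2 X :=
  tlift (fun u v => urmul v 1 (D (S u))) z.

Lemma contraction_bal : balanced (@ulact _ _ _ _ X) (@ulact _ _ _ _ X)
  (fun u v => urmul v 1 (D (S u))).
Proof.
split=> [u u' v|u v v'|a u v].
- by rewrite SD (coprodD (coprodP X)) urmulD.
- by rewrite urmulDl.
- by rewrite /ulact SM SA coprod_uAl urmulM mulr1.
Qed.

Lemma contraction_pure u v : contraction (upure u v) = urmul v 1 (D (S u)).
Proof. exact: (tlift_pure contraction_bal). Qed.

Lemma contractionD : {morph contraction : y z / y + z}.
Proof. exact: (tliftD contraction_bal). Qed.

Lemma contractionN : {morph contraction : z / - z}.
Proof. exact: (tliftN contraction_bal). Qed.

Lemma contraction_sum I (s : seq I) (F : I -> uenv2 X) :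
  contraction (\sum_(i <- s) F i) = \sum_(i <- s) contraction (F i).
Proof. exact: (big_morph _ contractionD (tlift0 contraction_bal)). Qed.

(** By induction on h. On ξ, the summand - ξ ⊗ 1 of the coproduct of S(ξ)
    cancels against the term coming from 1 ⊗ ξ. *)
Lemma contraction_coprod h : contraction (D h) = upure 1 (S h).
Proof.
have [cD cA cL cM] := coprodP X.
elim/uenv_ind: h => [a|xi|x y IHx IHy|x IHx|x y IHx IHy].
- by rewrite cA contraction_pure urmul11 SA cA upure_uA.
- rewrite cL contractionD !contraction_pure S1 SL coprod1 urmul11 urmul_pure.
  rewrite mul1r mulr1.
  rewrite /antipodeL cD coprodN cA cL upureDr upureNr opprD addrA addrAC subrK.
  by rewrite upure_uA.
- by rewrite cD contractionD IHx IHy SD upureDr.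
- by rewrite coprodN contractionN IHx antipodeN upureNr.
have [s hs] := tens_sum (D x); have [t ht] := tens_sum (D y).
rewrite (cM _ _ _ _ hs ht) exchange_big contraction_sum SM.
(* For fixed q, the sum over p is the product of S(q.1) acting on the
   contraction of the coproduct of x, to which the induction hypothesis
   applies, with q.2 ⊗ 1. *)
have step (q : V * V) :
    contraction (\sum_(p <- s) upure (p.1 * q.1) (p.2 * q.2)) =
    urmul 1 (S x) (contraction (upure q.1 q.2)).
  transitivity (urmul q.2 1 (uact (S q.1) (contraction (D x)))).
    rewrite hs contraction_sum [contraction (\sum_(i <- s) _)]contraction_sum.
    rewrite uact_sum urmul_sum.
    apply: eq_bigr => p _; rewrite !contraction_pure SM coprodM_uact.
    by rewrite uact_urmul urmulM mulr1.
  have -> : contraction (D x) = urmul 1 (S x) (upure 1 1).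
    by rewrite IHx urmul_pure !mul1r.
  rewrite uact_urmul.
  by rewrite contraction_pure !urmulM !mul1r !mulr1.
under eq_bigr do rewrite step.
rewrite -urmul_sum -contraction_sum -ht IHy.
by rewrite urmul_pure mul1r.
Qed.

Lemma antipode_left h (s : seq (V * V)) : D h = \sum_(p <- s) upure p.1 p.2 ->
  \sum_(p <- s) urmul p.2 1 (D (S p.1)) = upure 1 (S h).
Proof.
move=> hs; rewrite -contraction_coprod hs contraction_sum.
by apply: eq_bigr => p _; rewrite contraction_pure.
Qed.

(** The flip of [antipode_left]: the coproducts of h and of the elements S(u)
    are invariant under the flip, which exchanges the roles of the factors. *)
Lemma antipode_right h (s : seq (V * V)) : D h = \sum_(p <- s) upure p.1 p.2 ->
  \sum_(p <- s) urmul 1 p.1 (D (S p.2)) = upure (S h) 1.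
Proof.
move=> hs; rewrite -(uflip_pure 1).
rewrite -(@antipode_left h [seq (p.2, p.1) | p <- s]); last first.
  rewrite -uflip_coprod hs uflip_sum big_map.
  by apply: eq_bigr => p _; rewrite uflip_pure.
rewrite big_map uflip_sum; apply: eq_bigr => p _.
by rewrite uflip_urmul uflip_coprod.
Qed.

End AntipodeIdentities.

Lemma flat_character_antipode : admits_antipode X.
Proof.
have [S [SD S1 SM SA SL]] := antipode_exists.
have SK := antipodeK SD SM SA SL.
exists S, S; split=> //.
- by move=> c x; rewrite SM SA uenv_scale_central.
- exact: antipode_left.
- exact: antipode_right.
Qed.

End Antipode.
End RightCharacters.

(** * Jacobi algebras *)

Section JacobiAlgebra.
Variables (k : fieldType) (A : comPzRingType) (kA : {rmorphism k -> A}).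
Variables (J : A -> A -> A) (hJ : is_jacobi_algebra kA J).
Let lieJ := jacobi_lie hJ.

Lemma jacDl a b c : J (a + b) c = J a c + J b c.
Proof. exact: lieDl lieJ _ _ _. Qed.

Lemma jacDr a b c : J a (b + c) = J a b + J a c.
Proof. exact: lieDr lieJ _ _ _. Qed.

Lemma jacZl c a b : J (kA c * a) b = kA c * J a b.
Proof. exact: lieZl lieJ _ _ _. Qed.

Lemma jacZr c a b : J a (kA c * b) = kA c * J a b.
Proof. exact: lieZr lieJ _ _ _. Qed.

Lemma jac_anti a b : J a b = - J b a.
Proof.
have := lie_alt lieJ (a + b); rewrite jacDl !jacDr !(lie_alt lieJ) add0r addr0.
by move/eqP; rewrite addr_eq0 => /eqP.
Qed.

Lemma jac11 : J 1 1 = 0. Proof. exact: lie_alt lieJ _. Qed.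

Lemma jacMl a b c : J (a * b) c = a * J b c + b * J a c - a * b * J 1 c.
Proof. exact: jacobi_leibniz hJ _ _ _. Qed.

(** {a, -} is a first-order operator with value {a, 1} = - {1, a} at 1. *)
Lemma jacMr a b c : J a (b * c) = b * J a c + c * J a b + b * c * J 1 a.
Proof.
by rewrite jac_anti jacMl (jac_anti a b) (jac_anti a c); ring.
Qed.

Lemma jac_jacobi a b c : J a (J b c) = J (J a b) c + J b (J a c).
Proof.
have /eqP := lie_jacobi lieJ a b c.
rewrite (jac_anti (J a b)) (jac_anti c a) -mulN1r -[-1](rmorphN1 kA) jacZr.
rewrite rmorphN1 mulN1r -addrA addr_eq0 => /eqP ->.
by ring.
Qed.

(** The operator Φ_a; the second term corrects {a, -} to a derivation. *)
Definition hamiltonian a b := J a b + J 1 a * b.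
Local Notation ham := hamiltonian.

Lemma hamDl a b c : ham (a + b) c = ham a c + ham b c.
Proof. by rewrite /ham jacDl jacDr; ring. Qed.

Lemma hamDr a b c : ham a (b + c) = ham a b + ham a c.
Proof. by rewrite /ham jacDr; ring. Qed.

Lemma hamZl c a b : ham (kA c * a) b = kA c * ham a b.
Proof. by rewrite /ham jacZl jacZr; ring. Qed.

Lemma hamZr c a b : ham a (kA c * b) = kA c * ham a b.
Proof. by rewrite /ham jacZr; ring. Qed.

Lemma hamMr a b c : ham a (b * c) = b * ham a c + ham a b * c.
Proof. by rewrite /ham jacMr; ring. Qed.

Lemma hamMl a b c : ham (a * b) c = a * ham b c + b * ham a c - a * b * ham 1 c.
Proof. by rewrite /ham jacMl jacMr jac11; ring. Qed.

Lemma ham_jac a b c : ham (J a b) c = ham a (ham b c) - ham b (ham a c).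
Proof.
rewrite /ham !jacDr !jacMr (jac_jacobi a b c) (jac_jacobi 1 a b).
by rewrite (jac_anti (J 1 a) b); ring.
Qed.

Local Notation j1 := (jet1 kA).

(** * The Lie-Rinehart structure on jets *)

Lemma anchor_jet_balanced c : jet_balanced kA (fun a b => a * ham b c).
Proof.
split=> [a a' b|a b b'|x a b|a b d].
- by ring.
- by rewrite hamDl; ring.
- by rewrite hamZl; ring.
- by rewrite hamMl; ring.
Qed.

Definition jet_anchor (x : jet kA) c := jlift (fun a b => a * ham b c) x.

Lemma jet_anchor_gen a b c : jet_anchor (a *: j1 b) c = a * ham b c.
Proof. exact: jlift_gen (anchor_jet_balanced c) a b. Qed.

Lemma jet_anchorD x y c :
  jet_anchor (x + y) c = jet_anchor x c + jet_anchor y c.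
Proof. exact: jliftD (anchor_jet_balanced c) x y. Qed.

Lemma jet_anchorZ a x c : jet_anchor (a *: x) c = a * jet_anchor x c.
Proof.
elim/jet_ind: x => [b f|x y IHx IHy]; last first.
  by rewrite scalerDr !jet_anchorD IHx IHy; ring.
by rewrite scalerA !jet_anchor_gen; ring.
Qed.

Lemma jet_anchor1 b c : jet_anchor (j1 b) c = ham b c.
Proof. by rewrite -[j1 b]scale1r jet_anchor_gen mul1r. Qed.

Lemma jet_anchor_der x : is_derivation kA (jet_anchor x).
Proof.
split=> [a b|c a|a b]; elim/jet_ind: x => [d f|x y IHx IHy];
  rewrite ?jet_anchorD ?jet_anchor_gen.
- by rewrite hamDr; ring.
- by rewrite IHx IHy; ring.
- by rewrite hamZr; ring.
- by rewrite IHx IHy; ring.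
- by rewrite hamMr; ring.
- by rewrite IHx IHy; ring.
Qed.

(** The derivation terms Φ_f(a) jet1 g compensate for the failure of {f, -} to
    be a derivation. *)
Lemma ad_jet_balanced f :
  jet_balanced kA (fun b g => b *: j1 (J f g) + ham f b *: j1 g).
Proof.
split=> [a a' b|a b b'|x a b|a b d].
- by rewrite hamDr; module A.
- by rewrite jacDr !jet1D; module A.
- by rewrite hamZr jacZr !jet1Z; module A.
- rewrite !jacMr !hamMr !(jet1D, jet1M, jet1N).
  rewrite (jac_anti f 1) jet1N /ham.
  by module A.
Qed.

(** The bracket with jet1 f. *)
Definition jet_ad f (y : jet kA) : jet kA :=
  jlift (fun b g => b *: j1 (J f g) + ham f b *: j1 g) y.

Lemma jet_ad_gen f b g :
  jet_ad f (b *: j1 g) = b *: j1 (J f g) + ham f b *: j1 g.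
Proof. exact: jlift_gen (ad_jet_balanced f) b g. Qed.

Lemma jet_adD f x y : jet_ad f (x + y) = jet_ad f x + jet_ad f y.
Proof. exact: jliftD (ad_jet_balanced f) x y. Qed.

Lemma jet_adZ f a y : jet_ad f (a *: y) = a *: jet_ad f y + ham f a *: y.
Proof.
elim/jet_ind: y => [b g|x y IHx IHy].
  by rewrite scalerA !jet_ad_gen hamMr; module A.
by rewrite scalerDr !jet_adD IHx IHy; module A.
Qed.

(** The bracket of a jet1 f with y as forced by skew-symmetry and the Leibniz
    rule; the identities for f |-> jet_ad f y are checked on generators y. *)
Lemma bracket_jet_balanced y :
  jet_balanced kA (fun a f => a *: jet_ad f y - jet_anchor y a *: j1 f).
Proof.
have [dD dZ dM] := jet_anchor_der y.
have adD f f' : jet_ad (f + f') y = jet_ad f y + jet_ad f' y.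
  elim/jet_ind: y {dD dZ dM} => [b g|x y IHx IHy].
    by rewrite !jet_ad_gen jacDl hamDl jet1D; module A.
  by rewrite !jet_adD IHx IHy; module A.
have adZ c f : jet_ad (kA c * f) y = kA c *: jet_ad f y.
  elim/jet_ind: y {dD dZ dM adD} => [b g|x y IHx IHy].
    by rewrite !jet_ad_gen jacZl hamZl jet1Z; module A.
  by rewrite !jet_adD IHx IHy; module A.
have adM f g : jet_ad (f * g) y =
    f *: jet_ad g y + g *: jet_ad f y - (f * g) *: jet_ad 1 y
    - jet_anchor y f *: j1 g - jet_anchor y g *: j1 f
    + jet_anchor y (f * g) *: j1 1.
  elim/jet_ind: y {dD dZ dM adD adZ} => [b h|x y IHx IHy].
    rewrite !jet_ad_gen !jet_anchor_gen jacMl hamMl !(jet1D, jet1M, jet1N).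
    rewrite !hamMr /ham (jac_anti h f) (jac_anti h g).
    by module A.
  by rewrite !jet_adD !jet_anchorD IHx IHy; module A.
split=> [a a' f|a f f'|x a f|a f g].
- by rewrite dD; module A.
- by rewrite adD jet1D; module A.
- by rewrite adZ jet1Z dZ; module A.
- by rewrite adM !dM jet1M; module A.
Qed.

Definition jet_bracket (x y : jet kA) : jet kA :=
  jlift (fun a f => a *: jet_ad f y - jet_anchor y a *: j1 f) x.

Lemma jet_bracket_gen a f y :
  jet_bracket (a *: j1 f) y = a *: jet_ad f y - jet_anchor y a *: j1 f.
Proof. exact: jlift_gen (bracket_jet_balanced y) a f. Qed.

Lemma jet_bracketDl x y z :
  jet_bracket (x + y) z = jet_bracket x z + jet_bracket y z.
Proof. exact: jliftD (bracket_jet_balanced z) x y. Qed.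

Lemma jet_bracketDr x y z :
  jet_bracket x (y + z) = jet_bracket x y + jet_bracket x z.
Proof.
elim/jet_ind: x => [a f|x x' IHx IHx'].
  by rewrite !jet_bracket_gen jet_adD jet_anchorD; module A.
by rewrite !jet_bracketDl IHx IHx'; module A.
Qed.

Lemma jet_bracket_leibniz x a y :
  jet_bracket x (a *: y) = a *: jet_bracket x y + jet_anchor x a *: y.
Proof.
elim/jet_ind: x => [b f|x x' IHx IHx'].
  rewrite !jet_bracket_gen jet_adZ jet_anchorZ jet_anchor_gen.
  by module A.
by rewrite !jet_bracketDl IHx IHx' jet_anchorD; module A.
Qed.

Lemma jet_bracket_anti x y : jet_bracket x y = - jet_bracket y x.
Proof.
elim/jet_ind: x => [a f|x x' IHx IHx']; last first.
  by rewrite jet_bracketDl jet_bracketDr IHx IHx'; module A.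
elim/jet_ind: y => [b g|y y' IHy IHy']; last first.
  by rewrite jet_bracketDl jet_bracketDr IHy IHy'; module A.
rewrite !jet_bracket_gen !jet_ad_gen !jet_anchor_gen (jac_anti g) jet1N.
by module A.
Qed.

Lemma jet_bracket_alt x : jet_bracket x x = 0.
Proof.
elim/jet_ind: x => [a f|x y IHx IHy].
  rewrite jet_bracket_gen jet_ad_gen jet_anchor_gen (lie_alt lieJ) jet1_0.
  by module A.
rewrite jet_bracketDl !jet_bracketDr IHx IHy (jet_bracket_anti y x).
by module A.
Qed.

Lemma jet_bracket1 f g : jet_bracket (j1 f) (j1 g) = j1 (J f g).
Proof.
rewrite -[j1 f]scale1r -[j1 g]scale1r jet_bracket_gen jet_ad_gen jet_anchor_gen.
rewrite /ham (jac_anti f 1) (jac_anti g 1).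
by module A.
Qed.

Lemma jet_anchor_bracket x y c : jet_anchor (jet_bracket x y) c =
  jet_anchor x (jet_anchor y c) - jet_anchor y (jet_anchor x c).
Proof.
elim/jet_ind: x => [a f|x x' IHx IHx']; last first.
  rewrite jet_bracketDl !jet_anchorD IHx IHx' (derD (jet_anchor_der y)).
  by ring.
elim/jet_ind: y => [b g|y y' IHy IHy']; last first.
  rewrite jet_bracketDr !jet_anchorD IHy IHy' (derD (jet_anchor_der _)).
  by ring.
rewrite jet_bracket_leibniz jet_bracket_gen -[j1 g]scale1r jet_ad_gen.
rewrite !(jet_anchorD, jet_anchorZ, jet_anchor1).
rewrite -scaleNr jet_anchorZ jet_anchor1 !hamMr ham_jac.
have ham1 h : ham h 1 = 0 by rewrite /ham jac_anti; ring.
by rewrite !ham1; ring.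
Qed.

Lemma jet_bracketNr x y : jet_bracket x (- y) = - jet_bracket x y.
Proof.
apply: (addrI (jet_bracket x y)); rewrite -jet_bracketDr !subrr.
by apply: (addrI (jet_bracket x 0)); rewrite -jet_bracketDr !addr0.
Qed.

Definition jet_jacobiator x y z :=
  jet_bracket x (jet_bracket y z) + jet_bracket y (jet_bracket z x)
  + jet_bracket z (jet_bracket x y).

Lemma jet_jacobiatorC x y z : jet_jacobiator x y z = jet_jacobiator y z x.
Proof. by rewrite /jet_jacobiator; module A. Qed.

(** The terms in which the anchor differentiates a cancel since the anchor
    respects brackets and the bracket is skew-symmetric. *)
Lemma jet_jacobiatorZ a x y z :
  jet_jacobiator x y (a *: z) = a *: jet_jacobiator x y z.
Proof.
rewrite /jet_jacobiator !(jet_bracket_anti _ x).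
rewrite !(jet_bracket_anti _ (jet_bracket x y)).
rewrite !(jet_bracketNr, jet_bracketDr, jet_bracket_leibniz) jet_anchor_bracket.
by module A.
Qed.

Lemma jet_jacobiator_span x y :
  (forall b, jet_jacobiator x y (j1 b) = 0) ->
  forall z, jet_jacobiator x y z = 0.
Proof.
move=> jac0; apply: jet_span_ind => // [a z IHz|z z' IHz IHz'].
  by rewrite jet_jacobiatorZ IHz scaler0.
transitivity (jet_jacobiator x y z + jet_jacobiator x y z').
  by rewrite /jet_jacobiator !(jet_bracketDl, jet_bracketDr); module A.
by rewrite IHz IHz' addr0.
Qed.

Lemma jet_jacobiator0 x y z : jet_jacobiator x y z = 0.
Proof.
(* The Jacobiator is cyclically symmetric, so each argument can be made the
   last one. *)
apply: jet_jacobiator_span z => h; rewrite jet_jacobiatorC.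
apply: jet_jacobiator_span x => f; rewrite jet_jacobiatorC.
apply: jet_jacobiator_span y => g.
by rewrite /jet_jacobiator !jet_bracket1 -!jet1D (lie_jacobi lieJ) jet1_0.
Qed.

Lemma jet_bracketZr c x y : jet_bracket x (kA c *: y) = kA c *: jet_bracket x y.
Proof.
have dc : jet_anchor x (kA c) = 0.
  have [_ dZ dM] := jet_anchor_der x.
  have /eqP := dM 1 1; rewrite !(mul1r, mulr1).
  rewrite -subr_eq0 opprD addrA subrr add0r.
  by rewrite oppr_eq0 -[kA c]mulr1 dZ => /eqP ->; rewrite mulr0.
by rewrite jet_bracket_leibniz dc scale0r addr0.
Qed.

Lemma jet_bracket_lie : is_lie_algebra (fun c x => kA c *: x) jet_bracket.
Proof.
split.
- exact: jet_bracketDl.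
- exact: jet_bracketDr.
- move=> c x y.
  by rewrite jet_bracket_anti jet_bracketZr -scalerN -jet_bracket_anti.
- exact: jet_bracketZr.
- exact: jet_bracket_alt.
- exact: jet_jacobiator0.
Qed.

Definition jet_lieRinehart : lieRinehart kA (jet kA) :=
  LieRinehart jet_bracket_lie jet_anchor_der jet_anchorD jet_anchorZ
    jet_anchor_bracket jet_bracket_leibniz.

Lemma jacobi_jet_lieRinehart : jacobi_jet J jet_lieRinehart.
Proof. by split=> [a b|f g]; [apply: jet_anchor1 | apply: jet_bracket1]. Qed.

(** * The canonical character *)

Lemma character_jet_balanced : jet_balanced kA J.
Proof.
split=> [a a' b|a b b'|c a b|a b c].
- exact: jacDl.
- exact: jacDr.
- by rewrite jacZl jacZr.
- by rewrite !(jacMl, jacMr) (jac_anti b 1) (jac_anti a 1) (jac_anti c 1)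
    (jac_anti c b) jac11; ring.
Qed.

Definition jet_character : jet kA -> A := jlift J.

Lemma jet_character_gen a b : jet_character (a *: j1 b) = J a b.
Proof. exact: jlift_gen character_jet_balanced a b. Qed.

Lemma jet_characterD x y :
  jet_character (x + y) = jet_character x + jet_character y.
Proof. exact: jliftD character_jet_balanced x y. Qed.

Section Structure.
Variables (X : lieRinehart kA (jet kA)) (hX : jacobi_jet J X).

Lemma jet_character_right : right_character X jet_character.
Proof.
split; first exact: jet_characterD.
- move=> c x; elim/jet_ind: x => [a b|x y IHx IHy].
    by rewrite scalerA !jet_character_gen jacZl.
  by rewrite scalerDr !jet_characterD IHx IHy mulrDr.
move=> c x; elim/jet_ind: x => [a b|x y IHx IHy].
  rewrite scalerA !jet_character_gen anchorZ (proj1 hX) jacMl (jac_anti c b).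
  by ring.
by rewrite scalerDr !jet_characterD IHx IHy anchorD; ring.
Qed.

(** The curvature is skew-symmetric and A-bilinear, so jet1 f and jet1 g
    suffice; there it is the Jacobi identity for 1, f and g. *)
Lemma jet_character_flat : flat_character X jet_character.
Proof.
have [hA hB] := hX; have curvD := curvatureD jet_character_right.
have curvZ := curvatureZ jet_character_right.
have curvN := curvature_anti jet_character_right.
have span x : (forall b, curvature X jet_character x (j1 b) = 0) ->
    forall y, curvature X jet_character x y = 0.
  move=> curv0; apply: jet_span_ind => // [a y IHy|y z IHy IHz].
    by rewrite curvZ IHy mulr0.
  by rewrite curvD IHy IHz addr0.
move=> x y; apply: (span x) y => g; rewrite curvN.
rewrite (span (j1 g)) ?oppr0 // => f.
have phi1 b : jet_character (j1 b) = J 1 b.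
  by rewrite -[j1 b]scale1r jet_character_gen.
rewrite /curvature !hA hB !phi1 (jac_jacobi 1 g f) (jac_anti (J 1 g)).
by ring.
Qed.

End Structure.
End JacobiAlgebra.

Theorem theorem1p1 (k : fieldType) (A : comPzRingType)
    (kA : {rmorphism k -> A}) (J : A -> A -> A)
    (hJ : is_jacobi_algebra kA J) :
  (exists X : lieRinehart kA (jet kA), jacobi_jet J X) /\
  (forall X : lieRinehart kA (jet kA), jacobi_jet J X ->
     (exists phi : jet kA -> A,
        [/\ forall a b, phi (a *: jet1 kA b) = J a b,
            right_character X phi,
            flat_character X phi,
            right_connection X (connection_of phi)
          & flat_connection X (connection_of phi)]) /\
     admits_antipode X).
Proof.
split; first by exists (jet_lieRinehart hJ); apply: jacobi_jet_lieRinehart.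
move=> X hX; have rc := jet_character_right hJ hX.
have fl := jet_character_flat hJ hX.
split; last exact: flat_character_antipode rc fl.
exists (@jet_character _ _ kA J); split=> //.
- exact: jet_character_gen.
- exact: right_character_connection.
- exact: flat_character_connection.
Qed.
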